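(* Let $E$ be a KB-space with a quasi-interior point $e$ and let $\Theta=(T_n)_{n\in\mathbb N}$ be a positive LR-sequence on $E$. Then the following are equivalent: (i) there exist $g\in E_+$ and $\eta\in\mathbb R$ with $0\le\eta<1$ such that $$\lim_{n\to\infty}\mathrm{dist}(T_nx,\,[-g,g]+\eta B_E)=0\quad\text{for all }x\in B_E;$$ (ii) the sequence $\Theta$ is strongly convergent and $\dim\mathrm{Fix}(\Theta)<\infty$.
   Context: A Banach lattice $E$ is a KB-space if every increasing norm-bounded sequence in the positive cone $E_+=\{x\in E: x\ge 0\}$ is norm convergent. For $x\in E_+$, $[-x,x]=\{y\in E:|y|\le x\}$. An element $e\in E_+$ is a quasi-interior point if $\bigcup_{n\ge 0}[-ne,ne]$ is norm dense in $E$. $B_E=\{z\in E:\|z\|\le 1\}$, and $\mathrm{dist}(y,C)=\inf_{c\in C}\|y-c\|$. A sequence $\Theta=(T_n)_{n\in\mathbb N}$ of bounded linear operators on a Banach space $X$ is an LR-sequence if: (1) $\sup_n\|T_n\|<\infty$; (2) $\lim_{n\to\infty}\|T_n(T_m-I)x\|=0$ for every $m\in\mathbb N$ and every $x\in X$; (3) $\lim_{n\to\infty}\|(T_m-I)T_nx\|=0$ for every $m\in\mathbb N$ and every $x\in X$. It is positive (on a Banach lattice) if $T_nx\ge 0$ for all $x\ge 0$ and all $n$. $\Theta$ is strongly convergent if the norm limit $\lim_{n\to\infty}T_nx$ exists for every $x\in X$. $\mathrm{Fix}(\Theta)=\{x\in X: T_nx=x\text{ for all }n\in\mathbb N\}$.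 *)

(* Defs.v *)
From HB Require Import structures.
From mathcomp Require Import all_boot all_order all_algebra.
From mathcomp Require Import all_classical all_reals all_analysis.

Set Implicit Arguments.
Unset Strict Implicit.
Unset Printing Implicit Defensive.

Import Order.TTheory GRing.Theory Num.Theory.
Import numFieldNormedType.Exports.

Local Open Scope classical_set_scope.
Local Open Scope ring_scope.

(* HB cannot join [Order.Lattice] with normed modules (the numeric structures *)
(* declared earlier would have to inherit from the join), so the order is a   *)
(* field of the mixin and the library's lattice structure is derived from it  *)
(* just below: on [E : banachLatticeType R] one uses [x <= y] (ring_scope)    *)
(* and [Order.meet], [Order.join]; [`|x|] always denotes the norm.            *)
HB.mixin Record CompleteNormedModule_isBanachLattice (R : realType) E
    of CompleteNormedModule R E := {
  ble : rel E ;
  bmeet : E -> E -> E ;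
  bjoin : E -> E -> E ;
  ble_refl : reflexive ble ;
  ble_anti : antisymmetric ble ;
  ble_trans : transitive ble ;
  bmeetP : forall x y z, ble x (bmeet y z) = ble x y && ble x z ;
  bjoinP : forall x y z, ble (bjoin x y) z = ble x z && ble y z ;
  ble_add2r : forall z x y, ble x y -> ble (x + z) (y + z) ;
  ble_scale_ge0 : forall (a : R) x, 0 <= a -> ble 0 x -> ble 0 (a *: x) ;
  (* |x| <= |y| implies ||x|| <= ||y|| *)
  ble_norm : forall x y,
    ble (bjoin x (- x)) (bjoin y (- y)) -> `|x| <= `|y|
}.

#[short(type="banachLatticeType")]
HB.structure Definition BanachLattice (R : realType) :=
  { E of CompleteNormedModule R E & CompleteNormedModule_isBanachLattice R E }.

HB.instance Definition _ (R : realType) (E : banachLatticeType R) :=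
  Order.Le_isPOrder.Build ring_display E ble_refl ble_anti ble_trans.
HB.instance Definition _ (R : realType) (E : banachLatticeType R) :=
  Order.POrder_MeetJoin_isLattice.Build ring_display E bmeetP bjoinP.

Section NormedModule.
Context {R : realType} {E : normedModType R}.

Definition unit_ball : set E := [set z | `|z| <= 1].

Definition dist (y : E) (C : set E) : R := inf [set `|y - c| | c in C].

(* Operator norm; it is [+oo] exactly when [T] is unbounded. *)
Definition opnorm (T : E -> E) : \bar R :=
  ereal_sup [set (`|T x|)%:E | x in unit_ball].

Definition bounded_operator (T : E -> E) : Prop := (opnorm T < +oo)%E.

Definition LR_sequence (T : nat -> {linear E -> E}) : Prop :=
  [/\ forall n, bounded_operator (T n),
      (ereal_sup (range (fun n => opnorm (T n))) < +oo)%E,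
      forall m x, (fun n => `|T n (T m x - x)|) @ \oo --> (0 : R) &
      forall m x, (fun n => `|T m (T n x) - T n x|) @ \oo --> (0 : R)].

Definition strongly_convergent (T : nat -> {linear E -> E}) : Prop :=
  forall x, cvgn (fun n => T n x).

Definition Fix (T : nat -> {linear E -> E}) : set E :=
  [set x | forall n, T n x = x].

(* For a linear subspace [V]: [V] is spanned by finitely many of its vectors. *)
Definition finite_dim (V : set E) : Prop :=
  exists (d : nat) (b : 'I_d -> E), (forall i, V (b i)) /\
    forall x, V x -> exists a : 'I_d -> R, x = \sum_(i < d) a i *: b i.

End NormedModule.

Section BanachLattice.
Context {R : realType} {E : banachLatticeType R}.

Definition modulus (x : E) : E := Order.join x (- x).

(* [-x, x] *)
Definition order_ball (x : E) : set E := [set y | modulus y <= x].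

Definition quasi_interior (e : E) : Prop :=
  0 <= e /\ dense (\bigcup_n order_ball (e *+ n)).

Definition positive_sequence (T : nat -> {linear E -> E}) : Prop :=
  forall n x, 0 <= x -> 0 <= T n x.

End BanachLattice.

Definition KB_space (R : realType) (E : banachLatticeType R) : Prop :=
  forall u : nat -> E, (forall n, 0 <= u n) -> nondecreasing_seq u ->
    bounded_fun u -> cvgn u.

(* Main.v *)
Require Import Defs.
From mathcomp Require Import all_boot all_order all_algebra.
From mathcomp Require Import all_classical all_reals all_analysis.
From mathcomp Require Import lra ring.

Set Implicit Arguments.
Unset Strict Implicit.
Unset Printing Implicit Defensive.

Import Order.TTheory GRing.Theory Num.Theory.
Import numFieldNormedType.Exports.

Local Open Scope classical_set_scope.
Local Open Scope ring_scope.

(* (i) => (ii). For [x >= 0], forward convex combinations of the orbit of [x]  *)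
(* can be chosen so that all their truncations at the multiples [k e] converge *)
(* in norm (order intervals of a KB-space are weakly compact; here a strictly  *)
(* convex functional is minimised instead). The supremum [v] of these limits   *)
(* satisfies [T_n v <= v]. Hence, if [limsup |(T_n x - c)^+| <= r + eps] for a *)
(* suitable [c], the part of a convex combination above [k e] has norm about   *)
(* [r], and applying (i) to it replaces [r] by [eta r]; iterating, [r = 0]. So *)
(* orbits are almost order bounded, the convex combinations themselves         *)
(* converge, and the LR property turns this into convergence of [T_n x]. The   *)
(* limit [P] is a positive projection onto [Fix], which is a vector lattice    *)
(* with positive part [P (x^+)]; by (i) its unit ball lies below some          *)
(* [h \in Fix]. A normalised infinite disjoint sequence in [Fix] would have    *)
(* increasing partial sums below [h], contradicting the KB property; hence     *)
(* [Fix] is spanned by finitely many atoms.                                    *)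
(* (ii) => (i). A finite-dimensional subspace has an order bounded unit ball,  *)
(* so [eta = 0] works.                                                         *)

(** The sketch above rests on the following lemmas. An order interval [[0, c]] of a KB-space carries
    positive functionals that detect the norm up to any given error ([posfun_small]). Composed with
    a Riemann sum of [x ^ 2], such a functional becomes uniformly convex on [[0, c]]
    ([uniformly_convex_functional]), and near-minimisers of a weighted sum of countably many such
    functionals over the tail hulls are Cauchy at every truncation level at once ([small_mid_gaps],
    [forward_combinations]). This replaces weak compactness and yields the superfixed bound [v] of
    [superfixed_limit]. Splitting [T n x] into the image of the excess over [k e], to which (i)
    applies, and the image of a truncation, which stays essentially below [v], multiplies the excess
    by [eta] ([excess_contract], [excess0]). Convergence follows in [orbit_cvg_pos]. Dimension is
    controlled by [limit_bound], which sums a geometric series, and by [odisjoint_seq_vanishes]. The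
    converse is [combination_order_bound] applied to a spanning list of the fixed space. *)

(** * Ordered vectors *)

Section OrderedVectors.
Context {R : realType} {E : banachLatticeType R}.
Implicit Types x y z w : E.

Lemma bl_leD2r z x y : (x + z <= y + z) = (x <= y).
Proof.
apply/idP/idP => [/(ble_add2r (- z))|/(ble_add2r z)//].
by rewrite !addrK.
Qed.

Lemma bl_leD2l z x y : (z + x <= z + y) = (x <= y).
Proof. by rewrite ![z + _]addrC bl_leD2r. Qed.

Lemma bl_leD x y z w : x <= y -> z <= w -> x + z <= y + w.
Proof. by move=> xy zw; rewrite (@le_trans _ _ (y + z)) ?bl_leD2r ?bl_leD2l. Qed.

Lemma bl_leBlDr x y z : (x - y <= z) = (x <= z + y).
Proof. by rewrite -(bl_leD2r y (x - y)) subrK. Qed.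

Lemma bl_leBrDr x y z : (x <= y - z) = (x + z <= y).
Proof. by rewrite -(bl_leD2r z x) subrK. Qed.

Lemma bl_subr_ge0 x y : (0 <= y - x) = (x <= y).
Proof. by rewrite bl_leBrDr add0r. Qed.

Lemma bl_leN2 x y : (- x <= - y) = (y <= x).
Proof. by rewrite -[LHS]bl_subr_ge0 opprK addrC bl_subr_ge0. Qed.

Lemma bl_addr_ge0 x y : 0 <= x -> 0 <= y -> 0 <= x + y.
Proof. by move=> x0 y0; rewrite -[0]addr0 bl_leD. Qed.

Lemma bl_scale_ge0 (a : R) x : 0 <= a -> 0 <= x -> 0 <= a *: x.
Proof. exact: ble_scale_ge0. Qed.

Lemma bl_lescale (a : R) x y : 0 <= a -> x <= y -> a *: x <= a *: y.
Proof. by move=> a0 xy; rewrite -bl_subr_ge0 -scalerBr bl_scale_ge0 ?bl_subr_ge0. Qed.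

Lemma bl_lescaler (a b : R) x : 0 <= x -> a <= b -> a *: x <= b *: x.
Proof. by move=> x0 ab; rewrite -bl_subr_ge0 -scalerBl bl_scale_ge0 ?subr_ge0. Qed.

Lemma bl_sumr_ge0 (I : Type) (r : seq I) (f : I -> E) :
  (forall i, 0 <= f i) -> 0 <= \sum_(i <- r) f i.
Proof. by move=> f0; elim/big_ind: _ => //; exact: bl_addr_ge0. Qed.

Lemma bl_ler_sum (I : Type) (r : seq I) (f g : I -> E) :
  (forall i, f i <= g i) -> \sum_(i <- r) f i <= \sum_(i <- r) g i.
Proof. by move=> fg; elim/big_ind2: _ => // *; exact: bl_leD. Qed.

Definition pos x : E := Order.join x 0.

Lemma pos_ge0 x : 0 <= pos x. Proof. exact: leUr. Qed.
Lemma pos_ge x : x <= pos x. Proof. exact: leUl. Qed.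
Lemma pos_le x z : 0 <= z -> x <= z -> pos x <= z.
Proof. by move=> z0 xz; rewrite /pos leUx xz. Qed.

Lemma pos_id x : 0 <= x -> pos x = x.
Proof. by move=> x0; apply/le_anti; rewrite pos_ge pos_le. Qed.

Lemma pos_eq0 x : x <= 0 -> pos x = 0.
Proof. by move=> x0; apply/le_anti; rewrite pos_ge0 pos_le. Qed.

Lemma pos_mono x y : x <= y -> pos x <= pos y.
Proof. by move=> xy; rewrite pos_le ?pos_ge0// (le_trans xy)// pos_ge. Qed.

Lemma posB x : pos x - pos (- x) = x.
Proof.
apply/le_anti/andP; split.
  rewrite bl_leBlDr pos_le//; last by rewrite -{1}[x]addr0 bl_leD2l pos_ge0.
  by rewrite addrC -bl_leBlDr sub0r pos_ge.
rewrite bl_leBrDr addrC -bl_leBrDr pos_le ?bl_subr_ge0 ?pos_ge//.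
by rewrite bl_leBrDr addNr pos_ge0.
Qed.

Lemma posD x y : pos (x + y) <= pos x + pos y.
Proof. by rewrite pos_le ?bl_addr_ge0 ?pos_ge0// bl_leD ?pos_ge. Qed.

Lemma posZ (a : R) x : 0 <= a -> pos (a *: x) = a *: pos x.
Proof.
rewrite le_eqVlt => /predU1P[<-|a0]; first by rewrite !scale0r pos_id.
apply/le_anti/andP; split.
  by rewrite pos_le ?bl_scale_ge0 ?pos_ge0 ?(ltW a0)// bl_lescale ?pos_ge ?ltW.
rewrite -[leRHS](scalerKV (lt0r_neq0 a0)) bl_lescale ?(ltW a0)// pos_le//.
  by rewrite bl_scale_ge0 ?pos_ge0// invr_ge0 ltW.
by rewrite -[leLHS](scalerK (lt0r_neq0 a0)) bl_lescale ?pos_ge ?invr_ge0 ?ltW.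
Qed.

Lemma modulus_ge x : x <= modulus x. Proof. exact: leUl. Qed.
Lemma modulus_geN x : - x <= modulus x. Proof. exact: leUr. Qed.
Lemma modulus_le x z : x <= z -> - x <= z -> modulus x <= z.
Proof. by move=> xz nxz; rewrite /modulus leUx xz. Qed.

Lemma modulus_ge0 x : 0 <= modulus x.
Proof.
have h : 0 <= 2 *: modulus x.
  by rewrite scaler_nat mulr2n -(subrr x) bl_leD ?modulus_ge ?modulus_geN.
have n2 : (2 : R) != 0 by rewrite pnatr_eq0.
by rewrite -(scalerK n2 (modulus x)) bl_scale_ge0 ?invr_ge0.
Qed.

Lemma modulus_id x : 0 <= x -> modulus x = x.
Proof.
move=> x0; apply/le_anti; rewrite modulus_ge modulus_le//.
by rewrite (le_trans _ x0)// -oppr0 bl_leN2.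
Qed.

Lemma norm_le_modulus x y : modulus x <= y -> `|x| <= `|y|.
Proof.
move=> xy; apply: ble_norm; apply: (le_trans xy).
exact: modulus_ge.
Qed.

Lemma norm_between x y : - y <= x -> x <= y -> `|x| <= `|y|.
Proof.
move=> yx xy; apply: norm_le_modulus; rewrite modulus_le//.
by rewrite -[y]opprK bl_leN2.
Qed.

Lemma norm_mono x y : 0 <= x -> x <= y -> `|x| <= `|y|.
Proof. by move=> x0 xy; rewrite norm_le_modulus// modulus_id. Qed.

Lemma norm_modulus x : `|modulus x| = `|x|.
Proof.
apply/le_anti; rewrite [X in _ && X]norm_le_modulus// andbT; apply: ble_norm.
apply: (modulus_le (lexx _)); rewrite (le_trans _ (modulus_ge0 x))//.
by rewrite -oppr0 bl_leN2 modulus_ge0.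
Qed.

Lemma pos_le_modulus x : pos x <= modulus x.
Proof. by rewrite pos_le ?modulus_ge0 ?modulus_ge. Qed.

Lemma norm_pos x : `|pos x| <= `|x|.
Proof. by rewrite -(norm_modulus x) norm_mono ?pos_ge0 ?pos_le_modulus. Qed.

Lemma norm_posN_le x y : 0 <= y -> `|pos (- x)| <= `|y - x|.
Proof.
move=> y0; apply: le_trans (norm_pos (y - x)).
by rewrite norm_mono ?pos_ge0// pos_mono// -[leLHS]add0r bl_leD2r.
Qed.

(** The positive cone is norm closed: the negative part of [x] has norm at most the distance from
    [x] to any positive [y]. *)
Lemma bl_ge0_eps x : (forall eps : R, 0 < eps -> exists2 y, 0 <= y & `|y - x| <= eps) ->
  0 <= x.
Proof.
move=> h; have p0 : pos (- x) = 0.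
  apply/normr0_eq0/le_anti; rewrite normr_ge0 andbT.
  apply/ler_addgt0Pl => e e0; rewrite addr0.
  by have [y y0 ye] := h _ e0; rewrite (le_trans (norm_posN_le x y0)).
by rewrite -[x]posB p0 subr0 pos_ge0.
Qed.

(** Lets order inequalities be proved up to an error vector of small norm; most limit arguments
    below go through it. *)
Lemma bl_le_eps x z : (forall eps : R, 0 < eps -> exists2 y, x <= z + y & `|y| <= eps) ->
  x <= z.
Proof.
move=> h; rewrite -bl_subr_ge0; apply: bl_ge0_eps => e e0.
have [y xy ye] := h _ e0; exists (z + y - x); first by rewrite bl_subr_ge0.
by rewrite opprB addrA subrK addrAC subrr add0r.
Qed.

Lemma bl_cvg_le (u v : nat -> E) (a b : E) : u @ \oo --> a -> v @ \oo --> b ->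
  (\forall n \near \oo, u n <= v n) -> a <= b.
Proof.
move=> ua vb uv; apply: bl_le_eps => e e0.
have : (fun n => (u n - v n) - (a - b)) @ \oo --> (0 : E).
  by rewrite -(subrr (a - b)); apply: cvgB (cvg_cst _); exact: cvgB.
move=> /cvgr0Pnorm_le/(_ _ e0) ne; near \oo => n.
exists (- ((u n - v n) - (a - b))); last by rewrite normrN; near: n.
rewrite opprB addrA (addrC b) subrK -bl_subr_ge0 addrAC subrr add0r opprB.
by rewrite bl_subr_ge0; near: n.
Unshelve. all: by end_near. Qed.

Lemma bl_cvg_ge_cst (u : nat -> E) (a b : E) : u @ \oo --> a ->
  (\forall n \near \oo, b <= u n) -> b <= a.
Proof. by move=> ua; apply: bl_cvg_le ua; exact: cvg_cst. Qed.

Lemma bl_cvg_le_cst (u : nat -> E) (a b : E) : u @ \oo --> a ->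
  (\forall n \near \oo, u n <= b) -> a <= b.
Proof. by move=> ua; apply: bl_cvg_le ua _; exact: cvg_cst. Qed.

Lemma nondecreasing_cvg_le_bl (u : nat -> E) (a : E) : nondecreasing_seq u ->
  u @ \oo --> a -> forall n, u n <= a.
Proof.
move=> ndu ua n; apply: (bl_cvg_ge_cst ua); near=> m.
by apply: ndu; near: m; exact: nbhs_infty_ge.
Unshelve. all: by end_near. Qed.

End OrderedVectors.

(** * The Hahn-Banach theorem *)

Section HahnBanach.
Context {R : realType} {V : lmodType R}.
Implicit Types (p q : V -> R) (x y z : V).

Definition sublinear q :=
  (forall x y, q (x + y) <= q x + q y) /\
  (forall (a : R) x, 0 <= a -> q (a *: x) = a * q x).

Lemma sublinear0 q : sublinear q -> q 0 = 0.
Proof. by case=> _ /(_ 0 0 (lexx _)); rewrite scaler0 mul0r. Qed.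

Lemma sublinearN_ge q x : sublinear q -> - q (- x) <= q x.
Proof.
move=> sq; have := sq.1 x (- x); rewrite subrr sublinear0// => h; lra.
Qed.

Lemma poshomogeneous q : q 0 = 0 ->
  (forall (a : R) x, 0 < a -> q (a *: x) <= a * q x) ->
  forall (a : R) x, 0 <= a -> q (a *: x) = a * q x.
Proof.
move=> q0 qa a x; rewrite le_eqVlt => /predU1P[<-|a0].
  by rewrite scale0r mul0r q0.
apply/le_anti; rewrite qa//= -{1}(scalerK (lt0r_neq0 a0) x).
by rewrite -ler_pdivlMl// qa ?invr_gt0.
Qed.

(** The sublinear minorant of [q] obtained by forcing the value at [- z] down to at most [- q z]
    (take [t = 1]), which makes it linear along [z]. *)
Definition slope q z x : R :=
  inf [set q (x + t *: z) - t * q z | t in [set t : R | 0 <= t]].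

Section slope.
Variables (q : V -> R) (z : V).
Hypothesis sq : sublinear q.

Let slope_lb x :
  lbound [set q (x + t *: z) - t * q z | t in [set t : R | 0 <= t]] (- q (- x)).
Proof.
move=> _ [t t0 <-]; have := sq.1 (x + t *: z) (- x).
rewrite addrAC subrr add0r (sq.2 _ _ t0) => h; lra.
Qed.

Lemma slope_le x t : 0 <= t -> slope q z x <= q (x + t *: z) - t * q z.
Proof. by move=> t0; apply: ge_inf; [exists (- q (- x))|exists t]. Qed.

Lemma le_slope x b : (forall t, 0 <= t -> b <= q (x + t *: z) - t * q z) ->
  b <= slope q z x.
Proof.
move=> h; apply: lb_le_inf; first by exists (q (x + 0 *: z) - 0 * q z); exists 0 => /=.
by move=> _ [t t0 <-]; exact: h.
Qed.

Lemma slope_le_self x : slope q z x <= q x.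
Proof. by have := slope_le x (lexx 0); rewrite scale0r addr0 mul0r subr0. Qed.

Lemma sublinear_slope : sublinear (slope q z).
Proof.
split.
  move=> x y; rewrite -lerBlDr; apply: le_slope => s s0; rewrite lerBlDl -lerBlDr.
  apply: le_slope => t t0; have := slope_le (x + y) (addr_ge0 s0 t0).
  have := sq.1 (x + s *: z) (y + t *: z).
  rewrite addrACA -scalerDl => h1 h2; lra.
apply: poshomogeneous.
  apply/le_anti/andP; split; first by rewrite -(sublinear0 sq) slope_le_self.
  by apply: le_slope => t t0; rewrite add0r (sq.2 _ _ t0) subrr.
move=> a x a0; rewrite -ler_pdivrMl//; apply: le_slope => t t0.
rewrite ler_pdivrMl//; have := slope_le (a *: x) (mulr_ge0 (ltW a0) t0).
rewrite -scalerA -scalerDr (sq.2 _ _ (ltW a0)) mulrBr mulrA; exact.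
Qed.

End slope.

(** Zorn's lemma for the reversed pointwise order. A nonempty chain has its pointwise infimum as a
    bound: it is finite because every sublinear minorant of [p] is at least [- p (- x)], and it is
    subadditive because the smaller of two members of the chain serves for both summands. *)
Lemma minimal_sublinear p : sublinear p ->
  exists q, [/\ sublinear q, forall x, q x <= p x &
    forall q', sublinear q' -> (forall x, q' x <= q x) -> q' = q].
Proof.
move=> sp; pose T := {q | sublinear q /\ forall x, q x <= p x}.
pose r := fun s t : T => `[< forall x, sval t x <= sval s x >].
have T_ge (s : T) x : - p (- x) <= sval s x.
  case: s => q [sq qp] /=; apply: le_trans (sublinearN_ge x sq).
  by rewrite lerN2.
have [||s t /asboolP st /asboolP ts||m mP] := @Zorn T r.
- by move=> t; apply/asboolP => x.
- move=> s t u /asboolP st /asboolP tu; apply/asboolP => x.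
  exact: le_trans (tu _) (st _).
- apply: eq_sig_hprop => [q|]; first exact: Prop_irrelevance.
  by apply/funext => x; apply/le_anti; rewrite st ts.
- move=> A totA; have [A0|/set0P[s0 As0]] := eqVneq A set0.
    by exists (exist _ p (conj sp (fun x => lexx _))) => s; rewrite A0.
  pose S x := [set sval s x | s in A]; pose q x := inf (S x).
  have qle s x : A s -> q x <= sval s x.
    move=> As; apply: ge_inf; last by exists s.
    by exists (- p (- x)) => _ [t _ <-].
  have leq x b : (forall s, A s -> b <= sval s x) -> b <= q x.
    move=> h; apply: lb_le_inf; first by exists (sval s0 x); exists s0.
    by move=> _ [t At <-]; exact: h.
  have qsub : sublinear q.
    split.
      move=> x y; rewrite -lerBlDr; apply: (leq) => s As; rewrite lerBlDl -lerBlDr.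
      apply: (leq) => t At; rewrite lerBlDl.
      have [/asboolP st|/asboolP ts] := totA _ _ As At.
        apply: le_trans (qle _ _ At) _; apply: le_trans ((svalP t).1.1 _ _) _.
        by rewrite lerD2r st.
      apply: le_trans (qle _ _ As) _; apply: le_trans ((svalP s).1.1 _ _) _.
      by rewrite lerD2l ts.
    apply: poshomogeneous.
      apply/le_anti/andP; split.
        by rewrite -(sublinear0 (svalP s0).1) qle.
      by apply: (leq) => s _; rewrite (sublinear0 (svalP s).1).
    move=> a x a0; rewrite -ler_pdivrMl//; apply: (leq) => s As.
    by rewrite ler_pdivrMl// -(svalP s).1.2 ?(ltW a0)// qle.
  have qp x : q x <= p x by apply: le_trans (qle _ _ As0) ((svalP s0).2 _).
  by exists (exist _ q (conj qsub qp)) => s As; apply/asboolP => x; exact: qle.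
exists (sval m); split; [exact: (svalP m).1|exact: (svalP m).2|].
move=> q' sq' q'm.
have q'p x : q' x <= p x by apply: le_trans (q'm x) ((svalP m).2 x).
rewrite -(mP (exist _ q' (conj sq' q'p)))//.
by apply/asboolP.
Qed.

(* A minimal sublinear functional equals each of its slopes, hence is linear. *)
Lemma hahn_banach p z : sublinear p ->
  exists f : V -> R, [/\ sublinear f, forall x y, f (x + y) = f x + f y,
    forall x, f x <= p x & f z = p z].
Proof.
(* Minimising below [slope p z] instead of [p] forces [f (- z) <= - p z], hence [f z = p z]. *)
move=> sp; have ssp := sublinear_slope z sp.
have [f [sf fp fmin]] := minimal_sublinear ssp.
have fp' x : f x <= p x by apply: le_trans (fp x) (slope_le_self z sp x).
have fD x y : f (x + y) = f x + f y.
  apply/le_anti; rewrite sf.1 /=.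
  have e := fmin _ (sublinear_slope y sf) (slope_le_self y sf).
  have := slope_le y sf x ler01.
  by rewrite e scale1r mul1r lerBrDr.
exists f; split => //; apply/le_anti; rewrite fp' /=.
have := le_trans (fp (- z)) (slope_le z sp (- z) ler01).
rewrite scale1r addNr (sublinear0 sp) mul1r sub0r.
have := fD z (- z); rewrite subrr (sublinear0 sf) => h1 h2; lra.
Qed.

End HahnBanach.

(** * Positive functionals *)

Section PositiveFunctionals.
Context {R : realType} {E : banachLatticeType R}.
Implicit Types (x y z c : E) (f g : E -> R).

Lemma KB_cvg (u : nat -> E) (M : R) : KB_space E -> (forall n, 0 <= u n) ->
  nondecreasing_seq u -> (forall n, `|u n| <= M) -> cvgn u.
Proof.
move=> hE u0 ndu uM; apply: hE => //; rewrite /= /bounded_near; near=> K => n _ /=.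
by rewrite (le_trans (uM n))//; near: K; exact: nbhs_pinfty_ge.
Unshelve. all: by end_near. Qed.

Lemma KB_cvg_order (u : nat -> E) c : KB_space E -> (forall n, 0 <= u n) ->
  nondecreasing_seq u -> (forall n, u n <= c) -> cvgn u.
Proof.
by move=> hE u0 ndu uc; apply: (@KB_cvg u `|c|) => // n; exact: norm_mono.
Qed.

Lemma sublinear_norm_pos : sublinear (fun x : E => `|pos x|).
Proof.
split=> [x y|a x a0]; last by rewrite posZ// normrZ ger0_norm.
by rewrite (le_trans _ (ler_normD _ _))// norm_mono ?pos_ge0// posD.
Qed.

(** Bounding by the norm of the positive part encodes continuity and positivity together: for
    [x >= 0] it gives [f (- x) <= 0]. *)
Definition posfun f := [/\ sublinear f, forall x y, f (x + y) = f x + f y &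
  exists2 K : R, 0 <= K & forall x, f x <= K * `|pos x|].

Section theory.
Variable f : E -> R.
Hypothesis pf : posfun f.

Lemma posfun0 : f 0 = 0. Proof. by case: pf => /sublinear0. Qed.

Lemma posfunN x : f (- x) = - f x.
Proof. by apply/eqP; rewrite -addr_eq0; case: pf => _ <- _; rewrite addNr posfun0. Qed.

Lemma posfunB x y : f (x - y) = f x - f y.
Proof. by case: pf => _ -> _; rewrite posfunN. Qed.

Lemma posfunZ (a : R) x : 0 <= a -> f (a *: x) = a * f x.
Proof. by case: pf => -[_ h] _ _; exact: h. Qed.

Lemma posfun_ge0 x : 0 <= x -> 0 <= f x.
Proof.
move=> x0; case: pf => _ _ [K K0 /(_ (- x))].
rewrite posfunN pos_eq0 ?normr0 ?mulr0 ?oppr_le0//.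
by rewrite -oppr0 bl_leN2.
Qed.

Lemma posfun_mono x y : x <= y -> f x <= f y.
Proof. by rewrite -bl_subr_ge0 => /posfun_ge0; rewrite posfunB subr_ge0. Qed.

Lemma posfun_sum (I : Type) (r : seq I) (F : I -> E) :
  f (\sum_(i <- r) F i) = \sum_(i <- r) f (F i).
Proof. by apply: (big_morph f); [case: pf|exact: posfun0]. Qed.

End theory.

Lemma posfun_cst0 : posfun (fun=> 0).
Proof.
split; first by split=> *; rewrite /= ?addr0 ?mulr0.
- by move=> *; rewrite /= addr0.
- by exists 0 => // x; rewrite /= mul0r.
Qed.

Lemma posfun_add f g : posfun f -> posfun g -> posfun (fun x => f x + g x).
Proof.
move=> [[f1 f2] f3 [K K0 fK]] [[g1 g2] g3 [L L0 gL]]; split.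
- split=> [x y|a x a0]; last by rewrite f2// g2// mulrDr.
  by rewrite f3 g3 addrACA.
- by move=> x y; rewrite f3 g3 addrACA.
- by exists (K + L); [exact: addr_ge0|move=> x; rewrite mulrDl lerD].
Qed.

Lemma norming_posfun z : exists f, [/\ posfun f, forall x, f x <= `|pos x| &
  f z = `|pos z|].
Proof.
have [f [sf fD fp fz]] := hahn_banach z sublinear_norm_pos.
by exists f; split => //; split => //; exists 1 => // x; rewrite mul1r.
Qed.

(* Otherwise pick greedily norming functionals [g_k] of [z_k] in [[0, c]] of  *)
(* norm [> eps], [z_k] being almost annihilated by the previous [g_i]; then   *)
(* the decreasing sequence of the suprema of the tails is not Cauchy.         *)
Lemma posfun_small c (eps : R) : KB_space E -> 0 <= c -> 0 < eps ->
  exists f (delta : R), [/\ posfun f, 0 < delta &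
    forall z, 0 <= z -> z <= c -> f z <= delta -> `|z| <= eps].
Proof.
move=> hE c0 e0; apply: contrapT => hneg.
pose F := {f : E -> R | posfun f}.
(* The tolerances are summable, so all the later [z k] together contribute at most [eps / 2] to
   [g i]. *)
pose dl (k : nat) : R := eps / 2 ^+ k.+2.
have dl0 k : 0 < dl k by rewrite divr_gt0 ?exprn_gt0.
have /choice[Z ZP] : forall fk : F * nat, exists z,
    [/\ 0 <= z, z <= c, sval fk.1 z <= dl fk.2 & eps < `|z|].
  move=> [[f pf] k] /=; apply: contrapT => hz; apply: hneg.
  exists f, (dl k); split => // z z0 zc fz; rewrite leNgt; apply/negP => ez.
  by apply: hz; exists z.
have /choice[G GP] : forall z, exists g : F,
    (forall x, sval g x <= `|pos x|) /\ sval g z = `|pos z|.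
  by move=> z; have [f [pf fp fz]] := norming_posfun z; exists (exist _ f pf).
(* [fs k] is the sum of the norming functionals chosen before stage [k]; it dominates each of them
   on the cone, so a vector small for [fs k] is small for all of them. *)
pose fs := fix fs k : F := if k is k'.+1 then
  exist _ _ (posfun_add (svalP (fs k')) (svalP (G (Z (fs k', k')))))
  else exist _ _ posfun_cst0.
pose z k := Z (fs k, k); pose g k := sval (G (z k)).
have pg k : posfun (g k) := svalP (G (z k)).
have z0 k : 0 <= z k by case: (ZP (fs k, k)).
have zc k : z k <= c by case: (ZP (fs k, k)).
have zs k : sval (fs k) (z k) <= dl k by case: (ZP (fs k, k)).
have ez k : eps < `|z k| by case: (ZP (fs k, k)).
have gfs i k x : 0 <= x -> (i < k)%N -> g i x <= sval (fs k) x.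
  move=> x0; elim: k => // k IH; rewrite ltnS leq_eqVlt => /predU1P[->|/IH h] /=.
    by rewrite lerDr (posfun_ge0 (svalP (fs k))).
  by rewrite (le_trans h)// lerDl (posfun_ge0 (pg k)).
have gz i k : (i < k)%N -> g i (z k) <= dl k.
  by move=> ik; apply: le_trans (zs k); exact: gfs.
(* [S i n] is the supremum of [z i, ..., z (i + n)], and its limit [s i] is the supremum of the
   whole tail. *)
pose S i := fix S n := if n is n'.+1 then Order.join (S n') (z (i + n)%N) else z i.
have S_le i n b : (forall k, (i <= k)%N -> z k <= b) -> S i n <= b.
  move=> h; elim: n => [|n IH] /=; first exact: h.
  by rewrite leUx IH h// leq_addr.
have S_ge i n : z (i + n)%N <= S i n by case: n => [|n] /=; rewrite ?addn0// leUr.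
have ndS i : nondecreasing_seq (S i).
  by apply/nondecreasing_seqP => n /=; exact: leUl.
have S0 i n : 0 <= S i n by apply: le_trans (S_ge _ _).
have cS i : cvgn (S i).
  by apply: (KB_cvg_order hE (S0 i) (ndS i) (c := c)) => n; exact: S_le.
pose s i := limn (S i).
have zs_le i k : (i <= k)%N -> z k <= s i.
  move=> ik; rewrite -(subnKC ik); apply: le_trans (S_ge _ _) _.
  exact: nondecreasing_cvg_le_bl (ndS i) (cS i) _.
have s_le i b : (forall k, (i <= k)%N -> z k <= b) -> s i <= b.
  by move=> h; apply: (bl_cvg_le_cst (cS i)); near=> n; exact: S_le.
have gS i n : g i (S i.+1 n) <= eps / 2 - dl n.
  have dlS k : dl k.+1 = dl k / 2.
    by rewrite /dl [in LHS]exprS invfM mulrA mulrAC.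
  have dl_le k m : (k <= m)%N -> dl m <= dl k.
    by move=> km; rewrite ler_pM2l// lef_pV2 ?posrE ?exprn_gt0// ler_weXn2l ?ler1n.
  elim: n => [|n IH] /=.
    have := gz i i.+1 (ltnSn i); have := dl_le 1%N i.+1 isT.
    rewrite dlS /dl expr2 => h1 h2; lra.
  apply: le_trans (posfun_mono (pg i) (_ : _ <= S i.+1 n + z (i.+1 + n.+1)%N)) _.
    by rewrite leUx -{1}[S _ _]addr0 -{2}[z _]add0r !bl_leD.
  have [_ -> _] := pg i; have := gz i (i.+1 + n.+1)%N (leq_addr _ _).
  have := dl_le n.+1 (i.+1 + n.+1)%N (leq_addl _ _).
  rewrite dlS => h1 h2; lra.
have gs i : g i (s i.+1) <= eps / 2.
  apply/ler_addgt0Pl => e' e'0.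
  have /cvgrPdist_le/(_ _ e'0)[n _ /(_ n (leqnn n)) /= hn] := cS i.+1.
  have := (GP (z i)).1 (s i.+1 - S i.+1 n); rewrite -/(g i) (posfunB (pg i)).
  have := norm_pos (s i.+1 - S i.+1 n); have := gS i n; have := dl0 n.
  move: hn; rewrite -/(s i.+1) => h1 h2 h3 h4 h5; lra.
(* The tails [s i] decrease, so the KB property makes them converge. But [g n] exceeds [eps] at
   [s n] and is at most [eps / 2] at [s n.+1], so consecutive tails stay more than [eps / 2]
   apart. *)
have : cvgn (fun i => c - s i).
  apply: (KB_cvg_order (c := c) hE).
  - by move=> n; rewrite bl_subr_ge0; exact: s_le.
  - apply/nondecreasing_seqP => n; rewrite bl_leD2l bl_leN2.
    by apply: s_le => k nk; apply: zs_le; exact: ltnW.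
  - move=> n; rewrite bl_leBlDr -{1}[c]addr0 bl_leD2l.
    by apply: le_trans (zs_le n n _).
move=> cs; have e20 : 0 < eps / 2 by rewrite divr_gt0.
have /cvgrPdist_lt/(_ _ (divr_gt0 e20 (ltr0n R 2)))[n _ hn] := cs.
have h1 := hn n (leqnn n); have h2 := hn n.+1 (leqnSn n).
have : `|s n - s n.+1| < eps / 2.
  have -> : s n - s n.+1 = (limn (fun i => c - s i) - (c - s n)) -
      (limn (fun i => c - s i) - (c - s n.+1)).
    by rewrite (opprB (limn _)) [RHS]addrC subrKA opprB [RHS]addrC subrKA.
  by apply: le_lt_trans (ler_normB _ _) _; rewrite [ltRHS]splitr ltrD.
have := (GP (z n)).1 (s n - s n.+1); rewrite -/(g n) (posfunB (pg n)).
have := norm_pos (s n - s n.+1); have := gs n.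
have := posfun_mono (pg n) (zs_le n n (leqnn n)).
have := (GP (z n)).2; rewrite -/(g n) pos_id// => -> h3 h4 h5 h6 h7.
have := ez n; lra.
Unshelve. all: by end_near. Qed.

End PositiveFunctionals.

(** * Disjointness and uniform convexity *)

Section Disjointness.
Context {R : realType} {E : banachLatticeType R}.
Implicit Types (x y z w a b h : E) (F : set E).

(* The positive parts are computed in [F], not in the ambient lattice. *)
Definition lattice_subspace F :=
  [/\ F 0, forall (a : R) x y, F x -> F y -> F (a *: x + y) &
    forall x, F x -> exists p, [/\ F p, 0 <= p, x <= p &
      forall z, F z -> 0 <= z -> x <= z -> p <= z]].

(** Disjointness is relative to [F], to be used both in the whole space and in the fixed space,
    whose infima may differ from those of [E]. *)
Definition odisjoint F x y := forall w, F w -> 0 <= w -> w <= x -> w <= y -> w = 0.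

Lemma odisjoint_sym F x y : odisjoint F x y -> odisjoint F y x.
Proof. by move=> h w Fw w0 wy wx; exact: h. Qed.

Lemma odisjoint_le F x y x' y' : x' <= x -> y' <= y ->
  odisjoint F x y -> odisjoint F x' y'.
Proof.
by move=> xx yy h w Fw w0 wx wy; apply: h => //; [exact: le_trans xx|exact: le_trans yy].
Qed.

Lemma lattice_subspaceT : lattice_subspace [set: E].
Proof.
split=> // x _; exists (pos x); split; rewrite ?pos_ge0 ?pos_ge// => z _.
exact: pos_le.
Qed.

Section theory.
Variable F : set E.
Hypothesis lF : lattice_subspace F.

Lemma lsub0 : F 0. Proof. by case: lF. Qed.

Lemma lsubZ (a : R) x : F x -> F (a *: x).
Proof. by move=> Fx; rewrite -[_ *: _]addr0; case: lF => F0 h _; exact: h. Qed.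

Lemma lsubD x y : F x -> F y -> F (x + y).
Proof. by move=> Fx Fy; rewrite -[x]scale1r; case: lF => _ h _; exact: h. Qed.

Lemma lsubB x y : F x -> F y -> F (x - y).
Proof. by move=> Fx Fy; rewrite -[- y]scaleN1r; apply: lsubD => //; exact: lsubZ. Qed.

(** Here [p] is the positive part of [x] within [F] and [p - x] the negative part. Removing a common
    minorant [w] from [p] leaves a positive majorant of [x], so minimality of [p] forces [w = 0]. *)
Lemma odisjoint_posneg x p : F x -> F p ->
  (forall z, F z -> 0 <= z -> x <= z -> p <= z) -> odisjoint F p (p - x).
Proof.
move=> Fx Fp pmin w Fw w0 wp wn; apply/le_anti; rewrite w0 andbT.
have : p <= p - w.
  apply: pmin; rewrite ?bl_subr_ge0//; first exact: lsubB.
  by rewrite bl_leBrDr addrC -bl_leBrDr.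
by rewrite -{1}[p]addr0 bl_leD2l -{1}oppr0 bl_leN2.
Qed.

(** The positive part of [w - a] in [F] lies below both [w] and [b], hence vanishes. *)
Lemma le_add_disjoint w a b : F w -> F a -> F b -> 0 <= w -> 0 <= a -> 0 <= b ->
  w <= a + b -> odisjoint F w b -> w <= a.
Proof.
move=> Fw Fa Fb w0 a0 b0 wab wb.
have [_ _ /(_ _ (lsubB Fw Fa)) [p [Fp p0 pge pmin]]] := lF.
suff p00 : p = 0 by rewrite -[a]add0r -bl_leBlDr -p00.
apply: wb => //; apply: pmin => //.
  by rewrite bl_leBlDr -{1}[w]addr0 bl_leD2l.
by rewrite bl_leBlDr addrC.
Qed.

Lemma odisjointD a b x : F a -> F b -> 0 <= a -> 0 <= b ->
  odisjoint F a x -> odisjoint F b x -> odisjoint F (a + b) x.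
Proof.
move=> Fa Fb a0 b0 ax bx w Fw w0 wab wx; apply: ax => //.
by apply: (le_add_disjoint Fw Fa Fb) => //; apply/odisjoint_sym/(odisjoint_le _ wx).
Qed.

Lemma odisjointZr x y (r : R) : 0 <= y -> 0 <= r -> odisjoint F x y ->
  odisjoint F x (r *: y).
Proof.
move=> y0 r0 xy w Fw w0 wx wy; have r1 : 0 < r + 1 by rewrite ltr_wpDl.
(* Dividing by [r + 1] rather than [r] covers [r = 0] and keeps the scaled vector below [w] as well
   as below [y]. *)
have : (r + 1)^-1 *: w = 0.
  apply: xy; first exact: lsubZ.
  - by rewrite bl_scale_ge0 ?invr_ge0 ?(ltW r1).
  - apply: le_trans wx; rewrite -[leRHS]scale1r bl_lescaler// invf_le1//.
    by rewrite lerDr.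
  - rewrite -(scalerK (lt0r_neq0 r1) y) bl_lescale ?invr_ge0 ?(ltW r1)//.
    by apply: le_trans wy _; rewrite bl_lescaler// lerDl.
by move=> /eqP; rewrite scaler_eq0 invr_eq0 gt_eqF//= => /eqP.
Qed.

Lemma odisjoint_add_le a b h : F a -> F b -> F h -> 0 <= a -> 0 <= b ->
  a <= h -> b <= h -> odisjoint F a b -> a + b <= h.
Proof.
move=> Fa Fb Fh a0 b0 ah bh ab.
rewrite -bl_leBrDr; apply: (@le_add_disjoint _ _ b) => //; rewrite ?subrK//.
- exact: lsubB.
- by rewrite bl_subr_ge0.
Qed.

End theory.

(** Pointwise, if [X] exceeded [Y + s], some grid level would separate them. Without points: by
    induction on [i], [z = (X - Y - s)^+] is disjoint from [(i s - Y)^+], because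
    [z <= (X - (i + 1) s)^+ + (i s - Y)^+]. At [i = N] the vector [z] lies below [(N s - Y)^+] and
    so is disjoint from itself. *)
Lemma odisjoint_grid (s X Y : E) (N : nat) : 0 <= s -> 0 <= Y -> X <= s *+ N ->
  (forall i, (i <= N)%N -> odisjoint setT (pos (X - s *+ i)) (pos (s *+ i - Y))) ->
  X <= Y + s.
Proof.
move=> s0 Y0 XN XY; pose z := pos (X - Y - s).
have zi i : (i <= N)%N -> odisjoint setT z (pos (s *+ i - Y)).
  elim: i => [_|i IH iN] w _ w0 wz.
    rewrite mulr0n sub0r pos_eq0 => [w0'|]; first by apply/le_anti; rewrite w0 w0'.
    by rewrite -oppr0 bl_leN2.
  move=> wi; apply: (XY _ iN) => //.
  have tT := lattice_subspaceT.
  apply: (le_add_disjoint tT (b := pos (s *+ i - Y))); rewrite ?pos_ge0//.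
    apply: le_trans wz _; apply: le_trans (posD _ _); rewrite /z.
    suff -> : X - Y - s = X - s *+ i.+1 + (s *+ i - Y) by [].
    by rewrite mulrS opprD (addrA X (- s)) subrKA addrAC.
  exact: odisjoint_le (IH (ltnW iN)).
have z0 : z = 0.
  apply: (zi N) => //; first exact: pos_ge0.
  by apply: pos_mono; rewrite bl_leBlDr -[leLHS]addr0 !bl_leD// bl_leD2r.
by rewrite addrC -bl_leBlDr -[leRHS]add0r -bl_leBlDr -z0 pos_ge.
Qed.

(** Where [a] and [b] have opposite signs, the subadditivity of the positive part is strict by at
    least the smaller of [a^+] and [b^-]. *)
Lemma pos_convex_gap w a b : w <= pos a -> w <= pos (- b) ->
  w <= pos a + pos b - pos (a + b).
Proof.
move=> wa wb; rewrite bl_leBrDr addrC -bl_leBrDr; apply: pos_le.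
  by rewrite bl_subr_ge0 -[leLHS]addr0 bl_leD ?pos_ge0.
rewrite bl_leBrDr -addrA bl_leD ?pos_ge// -{1}(posB b) -addrA.
by rewrite -[leRHS]addr0 bl_leD2l addrC bl_leBlDr add0r.
Qed.

Lemma pos_add_le w a h : w <= pos (a - h) -> 0 <= h ->
  forall m, m <= h -> m <= pos a -> w + m <= pos a.
Proof.
move=> wh h0 m mh ma; rewrite -bl_leBrDr; apply: (le_trans wh).
apply: pos_le; first by rewrite bl_subr_ge0.
by rewrite bl_leD ?pos_ge// bl_leN2.
Qed.

(** If [m] is the meet of [a^+] and [b^+], a common minorant [w] of the shifted positive parts
    satisfies [w + m <= m]. *)
Lemma odisjoint_shift a b h : 0 <= h ->
  (forall m, m <= pos a -> m <= pos b -> m <= h) ->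
  odisjoint setT (pos (a - h)) (pos (b - h)).
Proof.
move=> h0 mh w _ w0 wa wb; pose m := Order.meet (pos a) (pos b).
have mle : m <= h by apply: mh; rewrite ?leIl ?leIr.
have : w + m <= m.
  by rewrite {2}/m lexI (pos_add_le wa)// ?(pos_add_le wb)// ?leIl ?leIr.
by rewrite -{2}[m]add0r bl_leD2r => w0'; apply/le_anti; rewrite w0 w0'.
Qed.

(** By homogeneity this is the vector-valued midpoint convexity gap of the Riemann sum of the
    [(x - i s)^+]. *)
Definition grid_gap (s : E) (N : nat) x y : E := \sum_(i < N.+1)
  (pos (x - s *+ i) + pos (y - s *+ i) - pos ((x - s *+ i) + (y - s *+ i))).

Lemma grid_gapC s N x y : grid_gap s N x y = grid_gap s N y x.
Proof. by apply: eq_bigr => i _; congr (_ - pos _); rewrite addrC. Qed.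

Lemma grid_gap_ge0 s N x y : 0 <= grid_gap s N x y.
Proof. by apply: bl_sumr_ge0 => i; rewrite bl_subr_ge0 posD. Qed.

(** With [h] the gap, [pos_convex_gap] bounds by [h] every common minorant of [(x - i s)^+] and
    [(i s - y)^+]. Shifting by [h] makes these parts disjoint, so [odisjoint_grid] applies to
    [x - h] and [y + h]. *)
Lemma le_grid_gap s N x y : 0 <= s -> 0 <= y -> x <= s *+ N ->
  x <= y + (s + grid_gap s N x y *+ 2).
Proof.
move=> s0 y0 xN; set h := grid_gap s N x y.
have h0 : 0 <= h by exact: grid_gap_ge0.
have : x - h <= (y + h) + s.
  apply: (@odisjoint_grid _ _ _ N) => //.
  - exact: bl_addr_ge0.
  - by rewrite bl_leBlDr -[leLHS]addr0 bl_leD.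
  move=> i iN; rewrite addrAC opprD addrA; apply: odisjoint_shift => // m ma mb.
  rewrite /h /grid_gap (bigD1 (Ordinal (iN : (i < N.+1)%N)))//= -[leLHS]addr0.
  apply: bl_leD; first by apply: pos_convex_gap => //; rewrite opprB.
  rewrite big_mkcond; apply: bl_sumr_ge0 => j; case: ifP => // _.
  by rewrite bl_subr_ge0 posD.
rewrite bl_leBlDr => /le_trans; apply.
by rewrite -!addrA mulr2n bl_leD2l addrC -addrA.
Qed.

Lemma norm_le_grid_gap s N x y : 0 <= s -> 0 <= x -> 0 <= y ->
  x <= s *+ N -> y <= s *+ N -> `|x - y| <= `|s| + `|grid_gap s N x y| *+ 2.
Proof.
move=> s0 x0 y0 xN yN; rewrite -normrMn; apply: le_trans (ler_normD _ _).
apply: norm_between.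
  by rewrite -[leRHS]opprB bl_leN2 bl_leBlDr addrC grid_gapC le_grid_gap.
by rewrite bl_leBlDr addrC le_grid_gap.
Qed.

Definition mid (V : lmodType R) (x y : V) : V := 2^-1 *: (x + y).

(* Up to scaling, [Phi x = sum_i f ((x - i c / N)^+)] is a Riemann sum of      *)
(* [f (x ^ 2)], so its midpoint convexity gap controls [x - y].                *)
Lemma uniformly_convex_functional c (eps : R) : KB_space E -> 0 <= c -> 0 < eps ->
  exists (Phi : E -> R) (b delta : R), [/\ 0 < delta,
    forall x, 0 <= Phi x, forall x, x <= c -> Phi x <= b,
    forall x y, 0 <= Phi x + Phi y - 2 * Phi (mid x y) &
    forall x y, 0 <= x -> 0 <= y -> x <= c -> y <= c ->
      Phi x + Phi y - 2 * Phi (mid x y) <= delta -> `|x - y| <= eps].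
Proof.
(* The mesh gives [|s| <= eps / 2]; the gap enters twice with norm at most [eps / 4], for a total of
   [eps]. *)
move=> hE c0 e0; pose N := (Num.truncn (2 * `|c| / eps)).+1.
pose s : E := N%:R^-1 *: c.
have s0 : 0 <= s by rewrite bl_scale_ge0 ?invr_ge0.
have sN : s *+ N = c by rewrite /s -scaler_nat scalerA mulfV ?scale1r ?pnatr_eq0.
have s_small : `|s| <= eps / 2.
  rewrite normrZ ger0_norm ?invr_ge0// ler_pdivrMl ?ltr0n// mulrC.
  have : 2 * `|c| / eps < N%:R by rewrite truncnS_gt.
  rewrite ltr_pdivrMr// => h; lra.
have cc0 : 0 <= (c + c) *+ N.+1 by rewrite -scaler_nat bl_scale_ge0 ?bl_addr_ge0.
have e40 : 0 < eps / 4 by rewrite divr_gt0.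
have [f [delta [pf d0 fsmall]]] := posfun_small hE cc0 e40.
pose Phi x := \sum_(i < N.+1) f (pos (x - s *+ i)).
have gapE x y : Phi x + Phi y - 2 * Phi (mid x y) = f (grid_gap s N x y).
  rewrite (posfun_sum pf) /Phi mulr_sumr -big_split -sumrB /=.
  apply: eq_bigr => i _; rewrite (posfunB pf); case: (pf) => _ -> _.
  congr (_ - _); rewrite -(posfunZ pf)// -posZ//; congr (f (pos _)).
  rewrite scalerBr /mid scalerA mulfV ?pnatr_eq0// scale1r.
  by rewrite scaler_nat mulr2n opprD addrACA.
have ile (i : 'I_N.+1) x : x - s *+ i <= x.
  by rewrite bl_leBlDr -{1}[x]addr0 bl_leD2l -scaler_nat bl_scale_ge0.
exists Phi, (\sum_(i < N.+1) f c), delta; split => //.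
- by move=> x; apply: sumr_ge0 => i _; rewrite (posfun_ge0 pf)// pos_ge0.
- move=> x xc; apply: ler_sum => i _; apply: (posfun_mono pf).
  by rewrite pos_le// (le_trans (ile i x)).
- by move=> x y; rewrite gapE (posfun_ge0 pf)// grid_gap_ge0.
move=> x y x0 y0 xc yc; rewrite gapE => /(fsmall _ (grid_gap_ge0 _ _ _ _)) h.
have {}h : `|grid_gap s N x y| <= eps / 4.
  apply: h; rewrite -[in leRHS](card_ord N.+1) -sumr_const.
  apply: bl_ler_sum => i; rewrite bl_leBlDr -[leLHS]addr0 bl_leD ?pos_ge0//.
  by rewrite bl_leD// pos_le// (le_trans (ile i _)).
apply: le_trans (norm_le_grid_gap (N := N) s0 x0 y0 _ _) _; rewrite ?sN//; lra.
Qed.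

End Disjointness.

(** * Forward combinations *)

Section MidpointHull.
Context {R : realType} {W : lmodType R}.
Implicit Types (S : set W) (x y w : W).

(** Iterated midpoints suffice in place of all convex combinations, since the gaps are measured at
    midpoints and every property needed later is stable under them. *)
Inductive mid_hull S : set W :=
| mid_hull_base x : S x -> mid_hull S x
| mid_hull_mid x y : mid_hull S x -> mid_hull S y -> mid_hull S (mid x y).

Lemma mid_hull_sub S S' : S `<=` S' -> mid_hull S `<=` mid_hull S'.
Proof.
move=> SS x; elim => [y /SS|y z _ hy _ hz]; first exact: mid_hull_base.
exact: mid_hull_mid.
Qed.

Definition tail_hull (p : nat -> W) (j : nat) : set W :=
  mid_hull [set p m | m in [set m | (j <= m)%N]].

Lemma tail_hull_sub p (j l : nat) : (j <= l)%N -> tail_hull p l `<=` tail_hull p j.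
Proof.
by move=> jl; apply: mid_hull_sub => _ [m /= lm <-]; exists m => //=; exact: leq_trans lm.
Qed.

Lemma tail_hull_ind p j (P : W -> Prop) :
  (forall m, (j <= m)%N -> P (p m)) -> (forall x y, P x -> P y -> P (mid x y)) ->
  forall x, tail_hull p j x -> P x.
Proof. by move=> hb hm x; elim=> [_ [m jm <-]|y z _ hy _ hz]; [exact: hb|exact: hm]. Qed.

Definition mid_gap (Phi : W -> R) x y := Phi x + Phi y - 2 * Phi (mid x y).

(** Let [y j] nearly minimise the weighted sum [Psi j] over the tail hull at [j], with infimum
    [V j]. For [j <= l] the midpoint of [y j] and [y l] still lies in the hull at [j], so the gap of
    [Psi j] is at most [V l - V j] plus small errors. The [V j] increase and are bounded by [1], so
    this tends to [0], and each [Phi i] occurs in [Psi j] with a fixed positive weight. *)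
Lemma small_mid_gaps (p : nat -> W) (Phi : nat -> W -> R) (b : nat -> R) :
  (forall i w, 0 <= Phi i w) ->
  (forall i w, tail_hull p 0 w -> Phi i w <= b i) ->
  (forall i x y, 0 <= mid_gap (Phi i) x y) ->
  exists y : nat -> W, (forall j, tail_hull p j (y j)) /\
    forall i (eps : R), 0 < eps -> exists J, forall j l, (J <= j)%N -> (j <= l)%N ->
      mid_gap (Phi i) (y j) (y l) <= eps.
Proof.
(* On the hull, [a i * Phi i] is at most [2 ^- i.+1], so [Psi j] is at most [1]. *)
move=> Phi0 Phib Phig; pose a i : R := (2 ^+ i.+1 * (1 + `|b i|))^-1.
have a0 i : 0 < a i by rewrite invr_gt0 mulr_gt0 ?exprn_gt0// ltr_wpDr.
pose Psi j w := \sum_(i < j.+1) a i * Phi i w.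
have Psi0 j w : 0 <= Psi j w.
  by apply: sumr_ge0 => i _; rewrite mulr_ge0// ltW.
have Psi1 j w : tail_hull p 0 w -> Psi j w <= 1.
  move=> hw; suff : Psi j w <= 1 - (2 ^+ j.+1)^-1.
    by move=> /le_trans; apply; rewrite gerBl invr_ge0 exprn_ge0.
  have aP i : a i * Phi i w <= (2 ^+ i.+1)^-1.
    rewrite /a invfM -mulrA ger_pMr ?invr_gt0 ?exprn_gt0// mulrC.
    rewrite ler_pdivrMr ?ltr_wpDr// mul1r (le_trans (Phib i w hw))//.
    by rewrite (le_trans (ler_norm _))// lerDr.
  rewrite /Psi; elim: j => [|j IH].
    rewrite big_ord_recl big_ord0 addr0 (le_trans (aP 0%N))// expr1; lra.
  rewrite big_ord_recr /= (le_trans (lerD IH (aP j.+1)))//.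
  have -> : (2 ^+ j.+2)^-1 = (2 ^+ j.+1)^-1 / 2 :> R by rewrite exprS invfM mulrC.
  lra.
have Psi_le j l w : (j <= l)%N -> Psi j w <= Psi l w.
  move=> /subnKC <-; elim: (l - j)%N => [|m IH]; first by rewrite addn0.
  rewrite addnS (le_trans IH)// /Psi [leRHS]big_ord_recr /= lerDl.
  by rewrite mulr_ge0// ltW.
pose V j := inf [set Psi j w | w in tail_hull p j].
have hp j : tail_hull p j (p j) by apply: mid_hull_base; exists j => /=.
have V_has j : has_inf [set Psi j w | w in tail_hull p j].
  split; first by exists (Psi j (p j)); exists (p j).
  by exists 0 => _ [w _ <-].
have V_le j w : tail_hull p j w -> V j <= Psi j w.
  by move=> hw; apply: ge_inf; [case: (V_has j)|exists w].
have V1 j : V j <= 1.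
  by apply: le_trans (V_le _ _ (hp j)) (Psi1 _ _ _); exact: (tail_hull_sub (leq0n j)).
have V_nd j l : (j <= l)%N -> V j <= V l.
  move=> jl; apply: lb_le_inf; first by case: (V_has l).
  move=> _ [w hw <-]; apply: le_trans (Psi_le _ _ w jl).
  by apply: V_le; exact: tail_hull_sub hw.
have /choice[y yP] : forall j, exists w, tail_hull p j w /\ Psi j w < V j + j.+1%:R^-1.
  move=> j; have j0 : 0 < (j.+1%:R^-1 : R) by rewrite invr_gt0.
  by have [_ [w hw <-] lt] := inf_adherent j0 (V_has j); exists w.
exists y; split=> [j|i e e0]; first by case: (yP j).
pose U := sup (range V).
have U_has : has_sup (range V).
  by split; [exists (V 0%N); exists 0%N|exists 1 => _ [j _ <-]].
have V_U j : V j <= U by apply: ub_le_sup; [case: U_has|exists j].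
have ae0 : 0 < a i * e / 2 by rewrite divr_gt0 ?mulr_gt0.
have [_ [J1 _ <-] hJ1] := sup_adherent ae0 U_has.
(* Past [J1] the growth of [V] is below [a i * e / 2]; past [J2] each of the two minimisation errors
   is at most [a i * e / 4]. *)
pose J2 := Num.truncn (4 / (a i * e)).
exists (maxn i (maxn J1 J2)) => j l; rewrite !geq_max => /and3P[ij J1j J2j] jl.
have gapE x z : mid_gap (Psi j) x z = \sum_(k < j.+1) a k * mid_gap (Phi k) x z.
  rewrite /mid_gap /Psi mulr_sumr -big_split -sumrB /=.
  by apply: eq_bigr => k _; ring.
have : a i * mid_gap (Phi i) (y j) (y l) <= mid_gap (Psi j) (y j) (y l).
  rewrite gapE (bigD1 (Ordinal (ij : (i < j.+1)%N)))//= lerDl.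
  by apply: sumr_ge0 => k _; rewrite mulr_ge0// ltW.
have h1 : V j <= Psi j (mid (y j) (y l)).
  apply: V_le; apply: mid_hull_mid; first by case: (yP j).
  by apply: (tail_hull_sub jl); case: (yP l).
have h2 := Psi_le _ _ (y l) jl; have [_ h3] := yP j; have [_ h4] := yP l.
have h5 : (l.+1%:R^-1 : R) <= j.+1%:R^-1 by rewrite lef_pV2 ?posrE// ler_nat.
have h6 : (j.+1%:R^-1 : R) <= a i * e / 4.
  rewrite -[leRHS]invrK lef_pV2 ?posrE ?invr_gt0 ?divr_gt0 ?mulr_gt0//.
  rewrite invf_div; apply/ltW/(lt_le_trans (truncnS_gt _)).
  by rewrite ler_nat ltnS.
have h7 := V_nd _ _ J1j; have h8 := V_U l.
move: hJ1; rewrite -/U => hJ1 h9; rewrite -(ler_pM2l (a0 i)).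
apply: le_trans h9 _; rewrite /mid_gap; move: h1 h2 h3 h4 h5 h6 h7 h8 hJ1.
by move: (l.+1%:R^-1) (j.+1%:R^-1) (a i * e) (V j) (V l) (V J1) => *; lra.
Qed.

End MidpointHull.

(** * Truncated orbits *)

Section Midpoints.
Context {R : realType} {E : banachLatticeType R}.
Implicit Types x y z a b c : E.

Lemma mid_id x : mid x x = x.
Proof. by rewrite /mid -mulr2n -(scaler_nat 2 x) scalerA mulVf ?scale1r ?pnatr_eq0. Qed.

Lemma mid_le a b x y : a <= x -> b <= y -> mid a b <= mid x y.
Proof. by move=> ax b_y; rewrite /mid bl_lescale ?invr_ge0// bl_leD. Qed.

Lemma mid_le_cst a b x : a <= x -> b <= x -> mid a b <= x.
Proof. by move=> ax bx; rewrite -[x]mid_id mid_le. Qed.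

Lemma mid_ge_cst a b x : x <= a -> x <= b -> x <= mid a b.
Proof. by move=> ax bx; rewrite -[x]mid_id mid_le. Qed.

Lemma norm_mid x y (r : R) : `|x| <= r -> `|y| <= r -> `|mid x y| <= r.
Proof.
move=> xr yr; rewrite /mid normrZ ger0_norm ?invr_ge0// ler_pdivrMl//.
by rewrite mulr_natl mulr2n (le_trans (ler_normD _ _))// lerD.
Qed.

Lemma midD a b x y : mid (a + x) (b + y) = mid a b + mid x y.
Proof. by rewrite /mid addrACA scalerDr. Qed.

Lemma midB a b x y : mid (a - x) (b - y) = mid a b - mid x y.
Proof. by rewrite /mid -scalerBr opprD addrACA. Qed.

Lemma linear_mid (T : {linear E -> E}) x y : T (mid x y) = mid (T x) (T y).
Proof. by rewrite /mid linearZ linearD. Qed.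

Lemma meetE x c : Order.meet x c = x - pos (x - c).
Proof.
apply/le_anti/andP; split.
  rewrite bl_leBrDr addrC -bl_leBrDr; apply: pos_le; first by rewrite bl_subr_ge0 leIl.
  by rewrite bl_leD2l bl_leN2 leIr.
rewrite lexI bl_leBlDr -{1}[x]addr0 bl_leD2l pos_ge0 /=.
by rewrite bl_leBlDr addrC -bl_leBlDr pos_ge.
Qed.

Lemma meet_le_perturb a b x y :
  Order.meet a b <= Order.meet x y + pos (b - y) + pos (a - x).
Proof.
rewrite -!bl_leBlDr lexI; apply/andP; split; rewrite !bl_leBlDr.
  apply: (le_trans (leIl _ _)); rewrite addrAC -[leLHS]addr0 bl_leD ?pos_ge0//.
  by rewrite addrC -bl_leBlDr pos_ge.
apply: (le_trans (leIr _ _)); rewrite -[leLHS]addr0 bl_leD ?pos_ge0//.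
by rewrite addrC -bl_leBlDr pos_ge.
Qed.

Lemma le_perturb x x' y y' a r : x' <= y' + a + r ->
  x <= y + a + ((x - x') + (y' - y) + r).
Proof.
move=> h; suff -> : y + a + ((x - x') + (y' - y) + r) = (y' + a + r) + (x - x').
  by rewrite -(bl_leD2r (x - x')) addrC subrK in h.
by rewrite -{2}[y'](subrK y) (AC (2*(2*1)) (((4*1)*2*5)*3)).
Qed.

Lemma norm_lim_le (u : nat -> E) a (r : R) : u @ \oo --> a ->
  (forall n, `|u n| <= r) -> `|a| <= r.
Proof. by move=> ua ur; apply: (cvgr_to_le (cvg_norm ua)); exact: nearW. Qed.

Lemma cauchy_seq_cvg (u : nat -> E) :
  (forall eps : R, 0 < eps -> exists J, forall j l, (J <= j)%N -> (j <= l)%N ->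
     `|u j - u l| <= eps) -> cvgn u.
Proof.
move=> h; apply/cauchy_cvgP/cauchy_exP => e e0.
have [J hJ] := h _ (divr_gt0 e0 (ltr0n R 2)); exists (u J); exists J => // n /= Jn.
rewrite -ball_normE /= (le_lt_trans (hJ _ _ _ Jn))//.
by rewrite ltr_pdivrMr// mulr_natr mulr2n ltrDl.
Qed.

(** The form in which density is used: every vector lies below a multiple of [e] up to a small
    norm. *)
Lemma quasi_interior_pos (e : E) : quasi_interior e -> forall y (eps : R), 0 < eps ->
  exists k, `|pos (y - e *+ k)| <= eps.
Proof.
move=> [e0 de] y eps eps0.
have yb : ball y eps !=set0 by exists y; exact: ballxx.
have [z [yz [k _ zk]]] := de _ yb (ball_open y eps).
exists k; move: yz; rewrite -ball_normE /= => yz; apply: le_trans (ltW yz).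
apply: le_trans (norm_pos _); apply: norm_mono; first exact: pos_ge0.
by apply: pos_mono; rewrite bl_leD2l bl_leN2 (le_trans (modulus_ge z)).
Qed.

End Midpoints.

Section Forward.
Context {R : realType} {E : banachLatticeType R}.
Variables (T : nat -> {linear E -> E}) (M : R) (e : E).
Hypothesis hE : KB_space E.
Hypothesis he : quasi_interior e.
Hypothesis M0 : 0 <= M.
Hypothesis TM : forall n x, `|T n x| <= M * `|x|.
Hypothesis Tpos : positive_sequence T.
Hypothesis T_left : forall m x, (fun n => `|T n (T m x - x)|) @ \oo --> (0 : R).
Hypothesis T_right : forall m x, (fun n => `|T m (T n x) - T n x|) @ \oo --> (0 : R).

Lemma T_mono n x y : x <= y -> T n x <= T n y.
Proof. by rewrite -bl_subr_ge0 => /(Tpos n); rewrite linearB bl_subr_ge0. Qed.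

Lemma T_cvg n (u : nat -> E) a : u @ \oo --> a -> (fun j => T n (u j)) @ \oo --> T n a.
Proof.
move=> /cvgrPdist_le ua; apply/cvgrPdist_le => d d0.
have M1 : 0 < M + 1 by rewrite ltr_wpDl.
near=> j; rewrite -linearB (le_trans (TM _ _))//.
apply: (@le_trans _ _ ((M + 1) * `|a - u j|)).
  by rewrite ler_wpM2r// lerDl.
rewrite -ler_pdivlMl// mulrC; near: j; apply: ua.
by rewrite divr_gt0.
Unshelve. all: by end_near. Qed.

(* Component [0] carries the orbit itself and component [k + 1] its truncation *)
(* at [k e], so that one choice of convex combinations serves all of them.    *)
Definition truncations (x : E) (m : nat) : nat -> E :=
  fun k => if k is k'.+1 then Order.meet (T m x) (e *+ k') else T m x.

Section orbit.
Variable x : E.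
Hypothesis x0 : 0 <= x.
Local Notation hull := (tail_hull (truncations x)).

Let e0 k : 0 <= e *+ k.
Proof. by rewrite -scaler_nat bl_scale_ge0//; case: he. Qed.

Let hull_ind j (P : (nat -> E) -> Prop) :=
  @tail_hull_ind R (nat -> E) (truncations x) j P.

Lemma hull_ge0 j k w : hull j w -> 0 <= w k.+1.
Proof.
move: w; apply: hull_ind => [m _|f g hf hg] /=; last by rewrite mid_ge_cst.
by rewrite lexI Tpos//= e0.
Qed.

Lemma hull_le j k w : hull j w -> w k.+1 <= e *+ k.
Proof.
by move: w; apply: hull_ind => [m _|f g hf hg] /=; [exact: leIr|exact: mid_le_cst].
Qed.

Lemma hull_le0 j k w : hull j w -> w k.+1 <= w 0%N.
Proof.
by move: w; apply: hull_ind => [m _|f g hf hg] /=; [exact: leIl|exact: mid_le].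
Qed.

Lemma hull_nd j k l w : (k <= l)%N -> hull j w -> w k.+1 <= w l.+1.
Proof.
move=> kl; move: w; apply: hull_ind => [m _|f g hf hg] /=; last exact: mid_le.
rewrite lexI leIl (le_trans (leIr _ _))//= -(subnKC kl) mulrnDr.
by rewrite -[leLHS]addr0 bl_leD2l e0.
Qed.

Lemma hull_norm j w : hull j w -> `|w 0%N| <= M * `|x|.
Proof.
by move: w; apply: hull_ind => [m _|f g hf hg] /=; [exact: TM|exact: norm_mid].
Qed.

Lemma hull_excess j k (r : R) w :
  (forall m, (j <= m)%N -> `|pos (T m x - e *+ k)| <= r) ->
  hull j w -> `|w 0%N - w k.+1| <= r.
Proof.
move=> hr; move: w; apply: hull_ind => [m jm|f g hf hg] /=.
  by rewrite meetE opprB addrC subrK hr.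
by rewrite -midB norm_mid.
Qed.

(** The left LR property makes every [T m x], hence every forward combination, asymptotically
    indistinguishable from [x]. *)
Lemma hull_orbit j w : hull j w -> (fun n => T n (w 0%N) - T n x) @ \oo --> (0 : E).
Proof.
move: w; apply: hull_ind => [m _|f g hf hg] /=.
  apply/cvgr0Pnorm_le => d d0; have /cvgr0Pnorm_le/(_ _ d0) := T_left m x.
  by apply: filterS => n; rewrite normr_id linearB.
rewrite -[0](mid_id (0 : E)).
have -> : (fun n => T n (mid (f 0%N) (g 0%N)) - T n x) =
    (fun n => mid (T n (f 0%N) - T n x) (T n (g 0%N) - T n x)).
  by apply/funext => n; rewrite linear_mid midB mid_id.
by apply: cvgZr; exact: cvgD.
Qed.

Lemma hull_fix j n (d : R) w :
  (forall m, (j <= m)%N -> `|T n (T m x) - T m x| <= d) ->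
  hull j w -> `|T n (w 0%N) - w 0%N| <= d.
Proof.
move=> hd; move: w; apply: hull_ind => [m jm|f g hf hg] /=; first exact: hd.
by rewrite linear_mid -midB norm_mid.
Qed.

(** [T n] maps the meet of [T m x] and [k e] below the meet of the images. There [T n (T m x)] is
    replaced by [T m x], at a cost of norm at most [d], and [T n (k e)] by [l e], at the cost of its
    part above [l e]. *)
Lemma hull_superfix j n k l (d : R) w :
  (forall m, (j <= m)%N -> `|T n (T m x) - T m x| <= d) ->
  hull j w -> exists2 r : E, `|r| <= d &
    T n (w k.+1) <= w l.+1 + pos (T n (e *+ k) - e *+ l) + r.
Proof.
move=> hd; move: w; apply: hull_ind => [m jm|f g [r rd hr] [s sd hs]] /=.
  exists (pos (T n (T m x) - T m x)); first by rewrite (le_trans (norm_pos _))// hd.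
  apply: le_trans (meet_le_perturb _ _ _ _).
  by rewrite lexI !T_mono ?leIl ?leIr.
exists (mid r s); first exact: norm_mid.
rewrite linear_mid -[pos _]mid_id -!midD; exact: mid_le.
Qed.

Lemma forward_combinations : exists w : nat -> nat -> E,
  (forall j, hull j (w j)) /\ forall k, cvgn (fun j => w j k.+1).
Proof.
have /choice[Q QP] : forall kN : nat * nat, exists Q : (E -> R) * (R * R),
  [/\ 0 < Q.2.2,
    forall x, 0 <= Q.1 x, forall x, x <= e *+ kN.1 -> Q.1 x <= Q.2.1,
    forall x y, 0 <= Q.1 x + Q.1 y - 2 * Q.1 (mid x y) &
    forall x y, 0 <= x -> 0 <= y -> x <= e *+ kN.1 -> y <= e *+ kN.1 ->
      Q.1 x + Q.1 y - 2 * Q.1 (mid x y) <= Q.2.2 -> `|x - y| <= kN.2.+1%:R^-1].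
  move=> [k N] /=; have N0 : 0 < (N.+1%:R^-1 : R) by rewrite invr_gt0.
  have [Phi [b [d [h1 h2 h3 h4 h5]]]] := uniformly_convex_functional hE (e0 k) N0.
  by exists (Phi, (b, d)).
(* One index codes a truncation level and a precision; an index that codes no pair just repeats the
   functional of [(0, 0)]. *)
pose dec i : nat * nat := odflt (0%N, 0%N) (unpickle i).
pose Phi i (w : nat -> E) := (Q (dec i)).1 (w (dec i).1.+1).
have [||i f g|w [hw wsmall]] := @small_mid_gaps R (nat -> E) (truncations x) Phi
  (fun i => (Q (dec i)).2.1).
- by move=> i w; case: (QP (dec i)) => _ + _ _ _; exact.
- by move=> i w hw; case: (QP (dec i)) => _ _ + _ _; apply; exact: hull_le hw.
- by case: (QP (dec i)) => _ _ _ + _; exact.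
exists w; split=> // k; apply: cauchy_seq_cvg => d d0.
pose N := Num.truncn d^-1; pose i := pickle (k, N).
have decE : dec i = (k, N) by rewrite /dec pickleK.
have [q0 _ _ _ q1] := QP (k, N).
have [J hJ] := wsmall i _ q0; exists J => j l Jj jl.
have /= := hJ _ _ Jj jl; rewrite /mid_gap /Phi decE => hgap.
have := q1 (w j k.+1) (w l k.+1) (hull_ge0 k (hw j)) (hull_ge0 k (hw l))
  (hull_le k (hw j)) (hull_le k (hw l)) hgap.
move=> /le_trans; apply.
rewrite -[leRHS]invrK lef_pV2 ?posrE ?invr_gt0//=.
by apply/ltW; rewrite truncnS_gt.
Qed.

(** The limits [om k] increase with [k] and are norm bounded, so they have a limit [v]. Passing to
    the limit in [hull_superfix] along [j], then [l], then [k] gives [T n v <= v]. *)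
Lemma superfixed_limit : exists (w : nat -> nat -> E) (omega : nat -> E) (v : E),
  [/\ forall j, hull j (w j), forall k, (fun j => w j k.+1) @ \oo --> omega k,
    forall k, omega k <= v & forall n, T n v <= v].
Proof.
have [w [hw cw]] := forward_combinations.
pose om k := limn (fun j => w j k.+1).
have om0 k : 0 <= om k.
  by apply: (bl_cvg_ge_cst (cw k)); near=> j; exact: hull_ge0 (hw j).
have om_nd : nondecreasing_seq om.
  move=> k l kl; apply: (bl_cvg_le (cw k) (cw l)).
  by near=> j; exact: hull_nd (hw j).
have om_bd k : `|om k| <= M * `|x|.
  apply: (norm_lim_le (cw k)) => j; apply: le_trans (hull_norm (hw j)).
  by apply: norm_mono; [exact: hull_ge0 (hw j)|exact: hull_le0 (hw j)].
have cv := KB_cvg hE om0 om_nd om_bd; pose v := limn om.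
exists w, om, v; split => //.
  exact: (nondecreasing_cvg_le_bl om_nd cv).
have T_om n k l : T n (om k) <= om l + pos (T n (e *+ k) - e *+ l).
  apply: bl_le_eps => d d0; have d3 : 0 < d / 3 by rewrite divr_gt0.
  have /cvgr0Pnorm_le/(_ _ d3)[J _ hJ] := T_right n x.
  have := @T_cvg n _ _ (cw k); move=> /cvgrPdist_le/(_ _ d3) h1.
  have := cw l; move=> /cvgrPdist_le/(_ _ d3) h2.
  near \oo => j.
  have Jj : (J <= j)%N by near: j; exact: nbhs_infty_ge.
  have [|r rd hr] := @hull_superfix j n k l (d / 3) (w j) _ (hw j).
    move=> m jm; have := hJ m (leq_trans Jj jm); rewrite /= normr_id; exact.
  exists (T n (om k) - T n (w j k.+1) + (w j l.+1 - om l) + r).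
    exact: le_perturb hr.
  have h1j : `|T n (om k) - T n (w j k.+1)| <= d / 3 by near: j; exact: h1.
  have h2j : `|om l - w j l.+1| <= d / 3 by near: j; exact: h2.
  rewrite (le_trans (ler_normD _ _))//.
  have := ler_normD (T n (om k) - T n (w j k.+1)) (w j l.+1 - om l).
  move: h2j; rewrite distrC => h2j h3j.
  lra.
have T_om_v n k : T n (om k) <= v.
  apply: bl_le_eps => d d0; have [l hl] := quasi_interior_pos he (T n (e *+ k)) d0.
  exists (pos (T n (e *+ k) - e *+ l)) => //.
  apply: (le_trans (T_om n k l)); rewrite bl_leD2r.
  exact: (nondecreasing_cvg_le_bl om_nd cv).
by move=> n; apply: (bl_cvg_le_cst (@T_cvg n _ _ cv)); near=> k; exact: T_om_v.
Unshelve. all: by end_near. Qed.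

End orbit.

End Forward.

(** * Convergence of the orbits *)

Section Attraction.
Context {R : realType} {E : banachLatticeType R}.
Variables (T : nat -> {linear E -> E}) (M : R) (e : E).
Hypothesis hE : KB_space E.
Hypothesis he : quasi_interior e.
Hypothesis M0 : 0 <= M.
Hypothesis TM : forall n x, `|T n x| <= M * `|x|.
Hypothesis Tpos : positive_sequence T.
Hypothesis T_left : forall m x, (fun n => `|T n (T m x - x)|) @ \oo --> (0 : R).
Hypothesis T_right : forall m x, (fun n => `|T m (T n x) - T n x|) @ \oo --> (0 : R).
Variables (g : E) (eta : R).
Hypothesis g0 : 0 <= g.
Hypothesis eta0 : 0 <= eta.
Hypothesis eta1 : eta < 1.
Hypothesis attr : forall x : E, unit_ball x ->
  (fun n => dist (T n x)
    [set a + b | a in order_ball g & b in [set eta *: z | z in unit_ball]])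
       @ \oo --> (0 : R).

Lemma attraction_unit x (d : R) : `|x| <= 1 -> 0 < d -> \forall n \near \oo,
  exists2 y, T n x <= g + y & `|y| <= eta + d.
Proof.
move=> x1 d0.
set C : set E := [set a + b | a in order_ball g & b in [set eta *: z | z in unit_ball]].
have /cvgrPdist_lt/(_ _ d0) := attr x1; apply: filterS => n.
rewrite distrC subr0 -/C => hn.
have hC : has_inf [set `|T n x - c| | c in C].
  split; last by exists 0 => _ [c _ <-].
  exists `|T n x - (0 + eta *: 0)|; exists (0 + eta *: 0) => //.
  exists 0; first by rewrite /order_ball /= modulus_id.
  by exists (eta *: 0) => //; exists 0 => //; rewrite /unit_ball /= normr0.
have d1 : 0 < d - dist (T n x) C by rewrite subr_gt0 (le_lt_trans (ler_norm _)).
have [_ [_ [a ag [_ [z z1 <-] <-]] <-]] := inf_adherent d1 hC.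
rewrite -[inf _]/(dist (T n x) C) subrKC => hd.
exists (eta *: z + (T n x - (a + eta *: z))).
  have e1 : T n x = a + (eta *: z + (T n x - (a + eta *: z))).
    by rewrite addrA subrKC.
  rewrite {1}e1.
  by rewrite bl_leD2r (le_trans (modulus_ge a)).
rewrite (le_trans (ler_normD _ _))// lerD ?(ltW hd)// normrZ ger0_norm//.
by rewrite -[leRHS]mulr1 ler_wpM2l.
Qed.

Lemma attraction x (rho d : R) : `|x| <= rho -> 0 < rho -> 0 < d ->
  \forall n \near \oo, exists2 y, T n x <= rho *: g + y & `|y| <= eta * rho + d.
Proof.
move=> xr r0 d0.
have x1 : `|rho^-1 *: x| <= 1.
  by rewrite normrZ ger0_norm ?invr_ge0 ?(ltW r0)// ler_pdivrMl// mulr1.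
have := attraction_unit x1 (divr_gt0 d0 r0); apply: filterS => n [y hy yd].
exists (rho *: y).
  have /(bl_lescale (ltW r0)) := hy.
  by rewrite linearZ scalerA mulfV ?gt_eqF// scale1r scalerDr.
rewrite normrZ ger0_norm ?(ltW r0)//.
apply: le_trans (ler_wpM2l (ltW r0) yd) _.
by rewrite mulrDr mulrC [rho * (d / _)]mulrC divfK// gt_eqF.
Qed.

Section orbit.
Variable x : E.
Hypothesis x0 : 0 <= x.

(** Measures how far the orbit is from being almost order bounded; [excess 0] is almost order
    boundedness of its tails. *)
Definition excess (r : R) := forall d : R, 0 < d -> exists c : E,
  \forall n \near \oo, `|pos (T n x - c)| <= r + d.

Lemma excess_quasi (r d : R) : excess r -> 0 < d -> exists k,
  \forall n \near \oo, `|pos (T n x - e *+ k)| <= r + d.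
Proof.
move=> hr d0; have d20 : 0 < d / 2 by rewrite divr_gt0.
have [c hc] := hr _ d20; have [k hk] := quasi_interior_pos he c d20.
exists k; apply: filterS hc => n hn.
have -> : r + d = r + d / 2 + d / 2 by rewrite -addrA -splitr.
apply: le_trans (lerD hn hk); apply: le_trans (ler_normD _ _).
apply: norm_mono; first exact: pos_ge0.
by apply: le_trans (posD _ _); rewrite addrA subrK.
Qed.

Lemma excess_contract (r : R) : 0 <= r -> excess r -> excess (eta * r).
Proof.
(* Four errors arise: [d1] from replacing [x] by [w j 0], [d1] from (i), at most [d1] from
   [eta * d1], and [M * d1] from replacing the truncation by its limit. *)
move=> r0 hr d d0; pose d1 := d / (3 + M).
have M3 : 0 < 3 + M by rewrite ltr_wpDr.
have d10 : 0 < d1 by rewrite divr_gt0.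
have [k [J _ hJ]] := excess_quasi hr d10.
have [w [om [v [hw cw omv Tv]]]] := superfixed_limit hE he M0 TM Tpos T_right x0.
have rho0 : 0 < r + d1 by rewrite ltr_wpDl.
exists ((r + d1) *: g + v).
have /cvgrPdist_le/(_ _ d10)[J' _ hJ'] := cw k.
pose j := maxn J J'.
have hj : `|w j 0%N - w j k.+1| <= r + d1.
  apply: (hull_excess _ (hw j)) => m jm; apply: hJ => /=.
  by apply: leq_trans jm; exact: leq_maxl.
have hjo : `|om k - w j k.+1| <= d1 by apply: hJ'; exact: leq_maxr.
have := attraction hj rho0 d10.
have := hull_orbit T_left (hw j) => /cvgr0Pnorm_le/(_ _ d10).
apply: filterS2 => n h1 [y hy yd].
pose z := T n x - T n (w j 0%N) + y + T n (w j k.+1 - om k).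
have zle : `|pos (T n x - ((r + d1) *: g + v))| <= `|z|.
  apply: le_trans (norm_pos z); apply: norm_mono; first exact: pos_ge0.
  apply: pos_mono; rewrite bl_leBlDr.
  (* The second term is absorbed by [(r + d1) g] up to [y], the last one by [v]; the other two are
     small. *)
  have -> : T n x = (T n x - T n (w j 0%N)) + T n (w j 0%N - w j k.+1) +
    T n (w j k.+1 - om k) + T n (om k).
    by rewrite !linearB !subrKA subrK.
  have := bl_leD hy (le_trans (T_mono Tpos n (omv k)) (Tv n)).
  rewrite /z; move: (T n x - _) (T n (_ - om k)) (T n (w j 0%N - _)) => A B C.
  move=> h; rewrite -(bl_leD2l (A + B)) in h.
  by rewrite [leLHS](ACl ((1*3)*(2*4))) [leRHS](AC (3*2) ((1*3)*((4*2)*5))).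
apply: le_trans zle _; rewrite /z.
have h2 : `|T n x - T n (w j 0%N)| <= d1 by rewrite distrC.
have h3 : `|T n (w j k.+1 - om k)| <= M * d1.
  by rewrite (le_trans (TM _ _))// ler_wpM2l// distrC.
rewrite (le_trans (ler_normD _ _))// (le_trans (lerD (ler_normD _ _) h3))//.
apply: le_trans (lerD (lerD h2 yd) (lexx _)) _.
have e1 : eta * (r + d1) <= eta * r + d1.
  by rewrite mulrDr lerD2l -[leRHS]mul1r ler_wpM2r ?(ltW d10)// ltW.
have e2 : d = d1 * 3 + M * d1 by rewrite (mulrC M) -mulrDr divfK// gt_eqF.
lra.
Qed.

Lemma excess0 : excess 0.
Proof.
have ek k : excess (eta ^+ k * (M * `|x|)).
  elim: k => [|k IH].
    move=> d d0; exists 0; near=> n; rewrite subr0 expr0 mul1r.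
    by rewrite (le_trans (norm_pos _))// (le_trans (TM _ _))// lerDl ltW.
  rewrite exprS -mulrA; apply: excess_contract => //.
  by rewrite mulr_ge0 ?exprn_ge0 ?mulr_ge0.
move=> d d0; have d20 : 0 < d / 2 by rewrite divr_gt0.
have : (fun k => eta ^+ k * (M * `|x|)) @ \oo --> (0 : R).
  by rewrite -[0](mul0r (M * `|x|)); apply: cvgMl; apply: cvg_expr; rewrite ger0_norm.
move=> /cvgr0Pnorm_le/(_ _ d20)[k _ /(_ k (leqnn k)) /= hk].
have [c hc] := ek k _ d20; exists c; apply: filterS hc => n /le_trans; apply.
by rewrite add0r [leRHS]splitr lerD2r (le_trans (ler_norm _)).
Unshelve. all: by end_near. Qed.

(** By [excess0] the combinations are uniformly close to their truncations at a single level, so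
    they are Cauchy themselves. The right LR property makes their limit [y] fixed. Since [T n x]
    follows [T n (w j 0)], which is close to [T n y = y], the orbit tends to [y]. *)
Lemma orbit_cvg_pos : cvgn (fun n => T n x).
Proof.
have [w [om [v [hw cw _ _]]]] := superfixed_limit hE he M0 TM Tpos T_right x0.
have cw0 : cvgn (fun j => w j 0%N).
  apply: cauchy_seq_cvg => d d0; have d4 : 0 < d / 4 by rewrite divr_gt0.
  have [k [J _ hJ]] := excess_quasi excess0 d4.
  have /cvgrPdist_le/(_ _ d4)[J' _ hJ'] := cw k.
  exists (maxn J J') => j l; rewrite geq_max => /andP[Jj J'j] jl.
  have hj i : (J <= i)%N -> `|w i 0%N - w i k.+1| <= d / 4.
    move=> Ji; rewrite -[leRHS]add0r; apply: (hull_excess _ (hw i)) => m im.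
    by apply: hJ; exact: leq_trans im.
  have h1 := hj _ Jj; have h2 := hj _ (leq_trans Jj jl).
  have h3 := hJ' _ J'j; have h4 := hJ' _ (leq_trans J'j jl).
  rewrite /= in h3 h4.
  have := ler_distD (w j k.+1) (w j 0%N) (w l 0%N).
  have := ler_distD (w l k.+1) (w j k.+1) (w l 0%N).
  have := ler_distD (om k) (w j k.+1) (w l k.+1).
  rewrite [`|w j k.+1 - om k|]distrC [`|w l k.+1 - w l 0%N|]distrC => h5 h6 h7.
  lra.
pose y := limn (fun j => w j 0%N).
have Ty n : T n y = y.
  apply/eqP; rewrite -subr_eq0 -normr_le0; apply/ler_addgt0Pr => d d0; rewrite add0r.
  have /cvgr0Pnorm_le/(_ _ d0)[J _ hJ] := T_right n x.
  apply: (cvgr_to_le (cvg_norm (cvgB (T_cvg M0 TM cw0) cw0))).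
  exists J => // j /= Jj; apply: (hull_fix _ (hw j)) => m jm.
  by have /= := hJ m (leq_trans Jj jm); rewrite normr_id.
apply/cvg_ex; exists y; apply/cvgrPdist_le => d d0.
have d20 : 0 < d / 2 by rewrite divr_gt0.
have M1 : 0 < M + 1 by rewrite ltr_wpDl.
have /cvgrPdist_le/(_ _ (divr_gt0 d20 M1))[j _ /(_ j (leqnn j)) /= hj] := cw0.
have := hull_orbit T_left (hw j) => /cvgr0Pnorm_le/(_ _ d20).
apply: filterS => n hn; rewrite [leRHS]splitr -(Ty n).
apply: le_trans (ler_distD (T n (w j 0%N)) _ _) _; apply: lerD => //.
rewrite -linearB (le_trans (TM _ _))// (le_trans (ler_wpM2l M0 hj))//.
by rewrite mulrA ler_pdivrMr// mulrC ler_wpM2l ?(ltW d20)// lerDl.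
Qed.

End orbit.

Lemma orbit_cvg x : cvgn (fun n => T n x).
Proof.
have -> : (fun n => T n x) = (fun n => T n (pos x) - T n (pos (- x))).
  by apply/funext => n; rewrite -linearB posB.
by apply: is_cvgB; apply: orbit_cvg_pos; exact: pos_ge0.
Qed.

End Attraction.

(** * Finite-dimensional lattice subspaces *)

Section FiniteDimension.
Context {R : realType} {E : banachLatticeType R}.
Variables (F : set E) (h : E).
Hypothesis hE : KB_space E.
Hypothesis lF : lattice_subspace F.
Hypothesis Fh : F h.
Hypothesis h_unit : forall x, F x -> x <= `|x| *: h.
Implicit Types (x y z w a b : E) (s : seq E).

(** After normalisation all terms lie below [h], and disjointness keeps their partial sums below
    [h]. The KB property makes these sums converge although their increments have norm [1]. *)
Lemma odisjoint_seq_vanishes (v : nat -> E) :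
  (forall i, [/\ F (v i), 0 <= v i & v i != 0]) ->
  (forall i j, (i < j)%N -> odisjoint F (v i) (v j)) -> False.
Proof.
move=> hv dv; have nv i : 0 < `|v i| by case: (hv i) => _ _; rewrite normr_gt0.
pose u i := `|v i|^-1 *: v i.
have nvV i : 0 <= `|v i|^-1 by rewrite invr_ge0.
have Fu i : F (u i) by apply: (lsubZ lF); case: (hv i).
have u0 i : 0 <= u i by apply: bl_scale_ge0 => //; case: (hv i).
have nu i : `|u i| = 1 by rewrite normrZ ger0_norm// mulVf// gt_eqF.
have uh i : u i <= h by rewrite -[h]scale1r -(nu i) h_unit.
have du i j : (i < j)%N -> odisjoint F (u i) (u j).
  move=> ij; have [_ vi0 _] := hv i; have [_ vj0 _] := hv j.
  apply: odisjointZr => //; apply: odisjoint_sym; apply: odisjointZr => //.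
  exact/odisjoint_sym/dv.
pose S n := \sum_(i < n) u i.
have SP n : [/\ F (S n), 0 <= S n, S n <= h &
    forall j, (n <= j)%N -> odisjoint F (S n) (u j)].
  elim: n => [|n [FS S0 Sh dS]]; rewrite /S ?big_ord0 ?big_ord_recr /= -?/(S n).
    split=> //; [exact: lsub0|by apply: le_trans (uh 0%N)|].
    by move=> j _ w _ w0 w0' _; apply/le_anti; rewrite w0 w0'.
  split.
  - exact: lsubD.
  - exact: bl_addr_ge0.
  - by apply: (odisjoint_add_le lF) => //; exact: dS.
  - by move=> j nj; apply: (odisjointD lF) => //; [apply: dS; exact: ltnW|exact: du].
have /cvg_ex[l /cvgrPdist_lt/(_ 2^-1)] : cvgn S.
  apply: (KB_cvg_order hE (c := h)); try by move=> n; case: (SP n).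
  apply/nondecreasing_seqP => n; rewrite /S big_ord_recr /=.
  by rewrite -{1}[\sum_(_ < n) _]addr0 bl_leD2l.
rewrite invr_gt0 ltr0n => /(_ isT)[n _ hn].
have := hn n (leqnn n); have := hn n.+1 (leqnSn n) => /= h1 h2.
have := ler_distD l (S n.+1) (S n).
rewrite {1}/S big_ord_recr /= -/(S n) addrAC subrr add0r nu distrC => h3; lra.
Qed.

Definition atom a := [/\ F a, 0 <= a, a != 0 &
  forall x y, F x -> F y -> 0 <= x -> 0 <= y -> x <= a -> y <= a ->
    odisjoint F x y -> x = 0 \/ y = 0].

(** Otherwise every nonzero positive element of [F] below [w] majorises two disjoint nonzero ones.
    Splitting the second of them again and again leaves the first ones as an infinite disjoint
    sequence. *)
Lemma exists_atom w : F w -> 0 <= w -> w != 0 -> exists2 a, atom a & a <= w.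
Proof.
move=> Fw w0 wn0; apply: contrapT => noatom.
pose X := {x | [/\ F x, 0 <= x, x != 0 & x <= w]}.
have /choice[f fP] : forall x : X, exists yz : X * X,
    [/\ sval yz.1 <= sval x, sval yz.2 <= sval x &
       odisjoint F (sval yz.1) (sval yz.2)].
  move=> [x [Fx x0 xn0 xw]] /=; apply: contrapT => nsplit.
  apply: noatom; exists x => //; split=> // y z Fy Fz y0 z0 yx zx yz.
  have [->|yn0] := eqVneq y 0; first by left.
  have [->|zn0] := eqVneq z 0; first by right.
  exfalso; apply: nsplit.
  exists (exist _ y (And4 Fy y0 yn0 (le_trans yx xw)),
          exist _ z (And4 Fz z0 zn0 (le_trans zx xw))).
  by split.
pose ws := fix ws n : X :=
  if n is n'.+1 then (f (ws n')).2 else exist _ w (And4 Fw w0 wn0 (lexx w)).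
have ws_le i j : (i <= j)%N -> sval (ws j) <= sval (ws i).
  move=> /subnKC <-; elim: (j - i)%N => [|m IH]; first by rewrite addn0.
  by rewrite addnS /=; apply: le_trans IH; case: (fP (ws (i + m)%N)).
apply: (@odisjoint_seq_vanishes (fun n => sval (f (ws n)).1)) => [i|i j ij].
  by case: (svalP (f (ws i)).1).
case: (fP (ws i)) => _ _; apply: odisjoint_le => //.
apply: (@le_trans _ _ (sval (ws j))); first by case: (fP (ws j)).
exact: (ws_le i.+1 j ij).
Qed.

Lemma maximal_coefficient x a : 0 <= x -> 0 <= a -> a != 0 ->
  exists c : R, [/\ 0 <= c, c *: a <= x & forall c' : R, c' *: a <= x -> c' <= c].
Proof.
move=> x0 a0 an0; have na : 0 < `|a| by rewrite normr_gt0.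
pose A := [set c : R | c *: a <= x].
have A0 : A 0 by rewrite /A /= scale0r.
have hA : has_sup A.
  split; first by exists 0.
  exists (`|x| / `|a|) => c /= cx; have [c0|/ltW c0] := leP 0 c.
    rewrite ler_pdivlMr// -{1}(ger0_norm c0) -normrZ.
    by apply: norm_mono => //; exact: bl_scale_ge0.
  by rewrite (le_trans c0)// divr_ge0.
exists (sup A); split.
- by apply: ub_le_sup => //; case: hA.
- apply: bl_le_eps => d d0; have [c /= Ac hc] := sup_adherent (divr_gt0 d0 na) hA.
  exists ((sup A - c) *: a).
    by rewrite -bl_leBlDr -scalerBl subKr.
  rewrite normrZ ger0_norm ?subr_ge0.
    by rewrite -ler_pdivlMr// lerBlDr -lerBlDl ltW.
  by apply: ub_le_sup => //; case: hA.
- by move=> c' c'x; apply: ub_le_sup => //; case: hA.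
Qed.

(** Let [c] be the largest coefficient with [c a <= w]. For [t > 0] the positive and negative parts
    of [w - (c + t) a] are disjoint and, the latter rescaled, below [a], so one of them vanishes.
    The negative part cannot, by maximality of [c]; hence [w <= (c + t) a], and [t] tends to [0]. *)
Lemma atom_multiple a w : atom a -> F w -> 0 <= w -> w <= a ->
  exists c : R, w = c *: a.
Proof.
move=> [Fa a0 an0 aP] Fw w0 wa; have na : 0 < `|a| by rewrite normr_gt0.
have [c [c0 ca cmax]] := maximal_coefficient w0 a0 an0.
exists c; apply/le_anti; rewrite ca andbT.
apply: bl_le_eps => d d0; pose t := d / `|a|.
have t0 : 0 < t by rewrite divr_gt0.
have ct0 : 0 < c + t by rewrite ltr_wpDl.
exists (t *: a); last by rewrite normrZ ger0_norm ?(ltW t0)// divfK// gt_eqF.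
pose z := w - (c + t) *: a.
have Fz : F z by apply: lsubB => //; exact: lsubZ.
have [_ _ /(_ _ Fz)[p [Fp p0 zp pmin]]] := lF.
have pw : p <= w.
  by apply: pmin => //; rewrite bl_leBlDr -{1}[w]addr0 bl_leD2l bl_scale_ge0 ?(ltW ct0).
have pz0 : 0 <= p - z by rewrite bl_subr_ge0.
have := odisjoint_posneg lF Fz Fp pmin.
move=> /(odisjointZr lF pz0 (_ : 0 <= (c + t)^-1)).
rewrite invr_ge0 => /(_ (ltW ct0)) /aP[||||||p00|].
- exact: Fp.
- by apply: lsubZ => //; exact: lsubB.
- exact: p0.
- by rewrite bl_scale_ge0 ?invr_ge0 ?(ltW ct0).
- exact: le_trans wa.
- rewrite -[leRHS](scalerK (lt0r_neq0 ct0)) bl_lescale ?invr_ge0 ?(ltW ct0)//.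
  by rewrite bl_leBlDr /z addrC subrK.
- by move: zp; rewrite p00 /z bl_leBlDr add0r scalerDl.
- move=> /eqP; rewrite scaler_eq0 invr_eq0 gt_eqF//= subr_eq0 => /eqP pz.
  have : (c + t) *: a <= w by rewrite -bl_subr_ge0 -/z -pz.
  by move=> /cmax; rewrite gerDl leNgt t0.
Qed.

(** Membership in the span of a list, peeled off one vector at a time to suit induction on the
    list. *)
Fixpoint combination s x :=
  if s is a :: s' then exists c : R, combination s' (x - c *: a) else x = 0.

Lemma combinationB s x y : combination s x -> combination s y -> combination s (x - y).
Proof.
elim: s x y => [|a s IH] x y /=; first by move=> -> ->; rewrite subr0.
move=> [c hc] [d hd]; exists (c - d); have := IH _ _ hc hd.
by rewrite scalerBl !opprB (AC (2*2) ((1*4)*(3*2))).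
Qed.

Lemma combination_sum s x : combination s x ->
  exists f : 'I_(size s) -> R, x = \sum_(i < size s) f i *: s`_i.
Proof.
elim: s x => [|a s IH] x /=; first by move=> ->; exists (fun=> 0); rewrite big_ord0.
move=> [c /IH[f xf]]; exists (fun i => if unlift ord0 i is Some j then f j else c).
rewrite big_ord_recl unlift_none /=.
under eq_bigr => i _ do rewrite liftK add0n.
by rewrite -xf subrKC.
Qed.

(** Subtract the largest possible multiple of each atom in turn. A common minorant of the residue
    and the atom is a multiple of the atom, and a positive coefficient would contradict
    maximality. *)
Lemma atoms_residue s x : (forall a, a \in s -> atom a) -> F x -> 0 <= x ->
  exists y, [/\ F y, 0 <= y, y <= x, forall a, a \in s -> odisjoint F y a &
    combination s (x - y)].
Proof.
move=> hs Fx x0; elim: s hs => [|a s IH] hs.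
  by exists x; rewrite subrr; split.
have [|y [Fy y0 yx ys cy]] := IH; first by move=> b bs; apply: hs; rewrite inE bs orbT.
have aa : atom a by apply: hs; rewrite mem_head.
have [Fa a0 an0 _] := aa.
have [c [c0 ca cmax]] := maximal_coefficient y0 a0 an0.
have yy : y - c *: a <= y by rewrite bl_leBlDr -{1}[y]addr0 bl_leD2l bl_scale_ge0.
exists (y - c *: a); split.
- by apply: lsubB => //; exact: lsubZ.
- by rewrite bl_subr_ge0.
- exact: le_trans yx.
- move=> b; rewrite inE => /predU1P[->|bs]; last exact: odisjoint_le (ys _ bs).
  move=> w Fw w0 wy wa; have [d wd] := atom_multiple aa Fw w0 wa.
  apply/le_anti; rewrite w0 andbT wd.
  have /cmax : (d + c) *: a <= y by rewrite scalerDl -wd -bl_leBrDr.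
  rewrite gerDr => d0; rewrite -oppr0 -[leLHS]opprK bl_leN2 -scaleNr.
  by rewrite bl_scale_ge0// oppr_ge0.
- by exists c; rewrite opprB addrA addrAC addrK.
Qed.

Lemma finite_dim_lattice_subspace : finite_dim F.
Proof.
apply: contrapT => ndim.
(* A list of atoms with no further disjoint atom would leave only zero residues and so span [F]. The
   hypothesis on [s] stands under the existential, so that choice yields a function on all lists. *)
have ext s : exists b, (forall a, a \in s -> atom a) ->
    atom b /\ forall a, a \in s -> odisjoint F b a.
  apply: contrapT => next; apply: ndim.
  have hs : forall a, a \in s -> atom a.
    apply: contrapT => hs; apply: next; exists 0; by [].
  have pos_comb x : F x -> 0 <= x -> combination s x.
    move=> Fx x0; have [y [Fy y0 yx ys cy]] := atoms_residue hs Fx x0.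
    have [y00|yn0] := eqVneq y 0; first by rewrite y00 subr0 in cy.
    exfalso; apply: next; have [b ab b_y] := exists_atom Fy y0 yn0.
    by exists b => _; split => // a as_; exact: odisjoint_le (ys _ as_).
  exists (size s), (fun i => s`_i); split.
    by move=> i; have [] := hs _ (mem_nth 0 (ltn_ord i)).
  move=> x Fx; apply: combination_sum.
  have [_ _ /(_ _ Fx)[p [Fp p0 xp pmin]]] := lF.
  rewrite -[x](subKr p); apply: combinationB; first exact: pos_comb.
  by apply: pos_comb; [exact: lsubB|rewrite bl_subr_ge0].
have [f fP] := choice ext.
pose ss := fix ss n := if n is n'.+1 then f (ss n') :: ss n' else [::].
have ssP n a : a \in ss n -> atom a.
  elim: n a => // n IH a; rewrite inE => /predU1P[->|/IH//].
  by have [] := fP (ss n) IH.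
have ss_mem i j : (i < j)%N -> f (ss i) \in ss j.
  elim: j => // j IH; rewrite ltnS leq_eqVlt inE => /predU1P[->|/IH->].
    by rewrite eqxx.
  by rewrite orbT.
apply: (@odisjoint_seq_vanishes (fun n => f (ss n))) => [i|i j ij].
  by have [[Fa a0 an0 _] _] := fP (ss i) (ssP i).
have [_ dj] := fP (ss j) (ssP j).
exact/odisjoint_sym/dj/ss_mem.
Qed.

End FiniteDimension.

(** * The limit projection *)

Section OrderBound.
Context {R : realType} {E : banachLatticeType R}.
Implicit Types (x y z a : E) (s : seq E).

Lemma combinationD s x y : combination s x -> combination s y -> combination s (x + y).
Proof.
elim: s x y => [|a s IH] x y /=; first by move=> -> ->; rewrite addr0.
move=> [c hc] [d hd]; exists (c + d); have := IH _ _ hc hd.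
by rewrite scalerDl opprD addrACA.
Qed.

Lemma combinationZ s (r : R) x : combination s x -> combination s (r *: x).
Proof.
elim: s x => [|a s IH] x /=; first by move=> ->; rewrite scaler0.
by move=> [c /IH hc]; exists (r * c); rewrite -scalerA -scalerBr.
Qed.

Lemma sum_combination (I : Type) (r : seq I) (b : I -> E) (f : I -> R) :
  combination (map b r) (\sum_(i <- r) f i *: b i).
Proof.
elim: r => [|i r IH] /=; first by rewrite big_nil.
by exists (f i); rewrite big_cons addrAC subrr add0r.
Qed.

(** Induction on the list. If the new vector [a] has distance at least [d > 0] from the old span,
    its coefficient in [x] is at most [|x| / d]. Otherwise [a] lies in the closure of the old span,
    and the old bound survives by approximation. *)
Lemma combination_order_bound s : exists2 G : E, 0 <= G &
  forall x, combination s x -> x <= `|x| *: G.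
Proof.
elim: s => [|a s [G G0 hG]] /=.
  by exists 0 => // x ->; rewrite normr0 scale0r.
have [[d d0 hd]|far] := pselect (exists2 d : R, 0 < d &
    forall y, combination s y -> d <= `|a - y|).
  exists (d^-1 *: modulus a + (1 + `|a| / d) *: G).
    rewrite bl_addr_ge0// bl_scale_ge0 ?invr_ge0 ?(ltW d0) ?modulus_ge0//.
    by rewrite addr_ge0// divr_ge0// ltW.
  move=> x [c hc]; have cx : `|c| <= `|x| / d.
    rewrite ler_pdivlMr//; have [->|c0] := eqVneq c 0; first by rewrite normr0 mul0r.
    have := hd _ (combinationZ (- c^-1) hc).
    rewrite scaleNr opprK scalerBr scalerA mulVf// scale1r subrKC.
    by rewrite normrZ normfV ler_pdivlMl ?normr_gt0.
  rewrite -{1}(subrKC (c *: a) x) scalerDr; apply: bl_leD.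
    apply: (@le_trans _ _ (`|c| *: modulus a)).
      have [c0|c0] := ler0P c.
        by rewrite -{1}[c]opprK scaleNr -scalerN bl_lescale ?modulus_geN ?oppr_ge0.
      by rewrite bl_lescale ?modulus_ge ?ltW.
    by rewrite scalerA bl_lescaler// modulus_ge0.
  apply: le_trans (hG _ hc) _; rewrite scalerA bl_lescaler//.
  rewrite (le_trans (ler_normB _ _))// normrZ mulrDr mulr1 lerD2l.
  by rewrite [leLHS]mulrC mulrCA ler_wpM2l.
exists G => // x [c hc]; apply: bl_le_eps => d d0.
(* Moving from [x] to [z] costs [|x - z|] once directly and once, times [|G|], through the change of
   norm; the final [1] keeps [K] positive. *)
pose K := `|c| * (`|G| + 1) + 1.
have K0 : 0 < K by rewrite ltr_wpDl// mulr_ge0 ?addr_ge0.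
have [y hy ay] : exists2 y, combination s y & `|a - y| < d / K.
  apply: contrapT => hy; apply: far; exists (d / K); first by rewrite divr_gt0.
  by move=> y sy; rewrite leNgt; apply/negP => ay; apply: hy; exists y.
pose z := c *: y + (x - c *: a).
have sz : combination s z by apply: combinationD => //; exact: combinationZ.
have xz : x - z = c *: (a - y).
  rewrite /z opprD opprB scalerBr -[RHS]add0r -(subrr x).
  by rewrite [LHS](AC (1*(1*2)) ((1*4)*(3*2))).
exists ((`|z| - `|x|) *: G + (x - z)).
  by rewrite addrA -scalerDl subrKC -[leLHS](subrKC z) bl_leD2r hG.
have nxz : `|x - z| <= `|c| * (d / K) by rewrite xz normrZ ler_wpM2l// ltW.
rewrite (le_trans (ler_normD _ _))// normrZ.
apply: (@le_trans _ _ (`|x - z| * (`|G| + 1))).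
  by rewrite mulrDr mulr1 lerD2r ler_wpM2r// distrC ler_dist_dist.
apply: le_trans (ler_wpM2r _ nxz) _; first by rewrite addr_ge0.
rewrite mulrAC mulrA ler_pdivrMr// mulrC ler_wpM2l ?(ltW d0)//.
by rewrite /K lerDl.
Qed.

Lemma finite_dim_order_bound (V : set E) : finite_dim V ->
  exists2 G : E, 0 <= G & forall x, V x -> x <= `|x| *: G.
Proof.
move=> [d [b [_ hb]]].
have [G G0 hG] := combination_order_bound (map b (index_enum 'I_d)).
by exists G => // x /hb[f xf]; apply: hG; rewrite xf; exact: sum_combination.
Qed.

End OrderBound.

Lemma LR_bound (R : realType) (E : normedModType R) (T : nat -> {linear E -> E}) :
  LR_sequence T -> exists2 M : R, 0 <= M & forall n x, `|T n x| <= M * `|x|.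
Proof.
move=> [_ bT _ _]; set S := ereal_sup _ in bT.
have ballS n x : `|x| <= 1 -> ((`|T n x|)%:E <= S)%E.
  move=> x1; apply: (@le_trans _ _ (opnorm (T n))).
    by apply: ereal_sup_ubound; exists x.
  by apply: ereal_sup_ubound; exists n.
have S0 : (0 <= S)%E by apply: le_trans (ballS 0%N 0 _); rewrite ?lee_fin ?normr0.
have Sfin : S \is a fin_num by rewrite ge0_fin_numE.
exists (fine S); first exact: fine_ge0.
move=> n x; have [->|xn0] := eqVneq x 0; first by rewrite linear0 !normr0 mulr0.
have nx : 0 < `|x| by rewrite normr_gt0.
have := ballS n (`|x|^-1 *: x); rewrite linearZ /= !normrZ ger0_norm ?invr_ge0//.
rewrite mulVf ?gt_eqF// lexx => /(_ isT).
by rewrite -[S in (_ <= S)%E](fineK Sfin) lee_fin ler_pdivrMl// mulrC.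
Qed.

(** * The limit operator and its range *)

Section Limit.
Context {R : realType} {E : banachLatticeType R}.
Variables (T : nat -> {linear E -> E}) (M : R).
Hypothesis M0 : 0 <= M.
Hypothesis TM : forall n x, `|T n x| <= M * `|x|.
Hypothesis Tpos : positive_sequence T.
Hypothesis T_right : forall m x, (fun n => `|T m (T n x) - T n x|) @ \oo --> (0 : R).
Hypothesis cT : forall x, cvgn (fun n => T n x).

Definition limit_operator (x : E) : E := limn (fun n => T n x).
Local Notation P := limit_operator.

Lemma limit_cvg x : (fun n => T n x) @ \oo --> P x.
Proof. exact: cT. Qed.
Arguments limit_cvg : clear implicits.

Lemma limit_unique x y : (fun n => T n x) @ \oo --> y -> P x = y.
Proof. by move=> h; apply: cvg_lim h. Qed.

Lemma limit_Fix x : Fix T (P x).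
Proof.
move=> m; apply/eqP; rewrite -subr_eq0 -normr_le0.
apply/ler_addgt0Pl => d d0; rewrite addr0; 
  apply: (cvgr_to_le (cvg_norm (cvgB (T_cvg M0 TM (limit_cvg x)) (limit_cvg x)))).
have /cvgr0Pnorm_le/(_ _ d0) := T_right m x.
by apply: filterS => n; rewrite normr_id.
Qed.

Lemma limit_id x : Fix T x -> P x = x.
Proof.
move=> Fx; apply: limit_unique; rewrite (_ : (fun n => T n x) = (fun=> x)).
  exact: cvg_cst.
by apply/funext => n; exact: Fx.
Qed.

Lemma limitD x y : P (x + y) = P x + P y.
Proof.
apply: limit_unique; rewrite (_ : (fun n => _) = (fun n => T n x + T n y)).
  by apply: cvgD; exact: limit_cvg.
by apply/funext => n; rewrite linearD.
Qed.

Lemma limitZ (a : R) x : P (a *: x) = a *: P x.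
Proof.
apply: limit_unique; rewrite (_ : (fun n => _) = (fun n => a *: T n x)).
  by apply: cvgZr; exact: limit_cvg.
by apply/funext => n; rewrite linearZ.
Qed.

Lemma limit_mono x y : x <= y -> P x <= P y.
Proof.
move=> xy; apply: (bl_cvg_le (limit_cvg x) (limit_cvg y)).
by near=> n; exact: T_mono.
Unshelve. all: by end_near. Qed.

Lemma limit_norm x : `|P x| <= M * `|x|.
Proof. by apply: norm_lim_le (limit_cvg x) _ => n; exact: TM. Qed.

Lemma limit_ge0 x : 0 <= x -> 0 <= P x.
Proof.
have P0 : P 0 = 0 by apply: limit_id => n; exact: linear0.
by rewrite -{2}P0; exact: limit_mono.
Qed.

(** A positive fixed majorant of [x] majorises [x^+]; applying the monotone [P], which fixes it,
    gives a majorant of [P (x^+)]. *)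
Lemma lattice_subspace_Fix : lattice_subspace (Fix T).
Proof.
split=> [n|a x y Fx Fy n|x Fx]; first exact: linear0.
  by rewrite linearP Fx Fy.
exists (P (pos x)); split.
- exact: limit_Fix.
- exact/limit_ge0/pos_ge0.
- by rewrite -{1}(limit_id Fx) limit_mono// pos_ge.
- by move=> z Fz z0 xz; rewrite -(limit_id Fz) limit_mono// pos_le.
Qed.

Section attracted.
Variables (g : E) (eta : R).
Hypothesis g0 : 0 <= g.
Hypothesis eta0 : 0 <= eta.
Hypothesis eta1 : eta < 1.
Hypothesis attr : forall x : E, unit_ball x ->
  (fun n => dist (T n x)
    [set a + b | a in order_ball g & b in [set eta *: z | z in unit_ball]])
       @ \oo --> (0 : R).

(** The value [(1 + eta) / 2] is [eta] plus two errors [(1 - eta) / 4], and it is still below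
    [1]. *)
Lemma limit_attraction x : `|x| <= 1 ->
  exists2 y, P x <= g + y & `|y| <= (1 + eta) / 2.
Proof.
move=> x1; have d0 : 0 < (1 - eta) / 4 by rewrite divr_gt0// subr_gt0.
have h1 := attraction_unit g0 eta0 attr x1 d0.
have /cvgrPdist_le/(_ _ d0) h2 := limit_cvg x.
have [N _ hN] := filterI h1 h2.
have [[y hy yd] /= hP] := hN N (leqnn N).
exists (y + (P x - T N x)).
  by rewrite addrA -[leLHS](subrKC (T N x)) bl_leD2r.
rewrite (le_trans (ler_normD _ _))// (le_trans (lerD yd hP))//; lra.
Qed.

Lemma limit_bound : exists2 h, Fix T h & forall x, Fix T x -> x <= `|x| *: h.
Proof.
pose q := (1 + eta) / 2; have q0 : 0 < q by rewrite divr_gt0// ltr_wpDr.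
have q1 : 0 < 1 - q by rewrite subr_gt0 ltr_pdivrMr// mul1r mulr2n ltrD2l.
(* The sum of the geometric series [P g + q P g + ...], that is, the solution of [h = P g + q h], to
   which iterating [limit_attraction] leads. *)
pose h := (1 - q)^-1 *: P g.
have h0 : 0 <= h by rewrite bl_scale_ge0 ?limit_ge0 ?invr_ge0 ?(ltW q1).
have hq : P g + q *: h = h.
  rewrite -[P g](scalerKV (lt0r_neq0 q1)) -/h -scalerDl subrK scale1r.
  by [].
have bound k x : `|x| <= 1 -> exists2 y, P x <= h + P y & `|y| <= q ^+ k.
  elim: k x => [|k IH] x x1.
    by exists x => //; rewrite -{1}[P x]add0r bl_leD2r.
  have [y hy yq] := limit_attraction x1.
  have [|z hz zq] := IH (q^-1 *: y).
    by rewrite normrZ ger0_norm ?invr_ge0 ?(ltW q0)// ler_pdivrMl// mulr1.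
  exists (q *: z); last first.
    by rewrite normrZ ger0_norm ?(ltW q0)// exprS ler_wpM2l// ltW.
  rewrite -(limit_id (limit_Fix x)); apply: le_trans (limit_mono hy) _.
  rewrite limitD -{1}hq -addrA bl_leD2l limitZ -scalerDr.
  rewrite -{1}(scalerKV (lt0r_neq0 q0) y) limitZ.
  by rewrite bl_lescale// ltW.
have Ph x : `|x| <= 1 -> P x <= h.
  move=> x1; apply: bl_le_eps => d d0.
  have : (fun k => M * q ^+ k) @ \oo --> (0 : R).
    rewrite -[0](mulr0 M); apply: cvgMr; apply: cvg_expr.
    by rewrite ger0_norm ?(ltW q0)// -subr_gt0.
  move=> /cvgr0Pnorm_le/(_ _ d0)[k _ /(_ k (leqnn k)) /= hk].
  have [y hy yq] := bound k x x1; exists (P y) => //.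
  apply: le_trans (limit_norm _) _; apply: le_trans (le_trans (ler_norm _) hk).
  exact: ler_wpM2l.
exists h; first exact: (lsubZ lattice_subspace_Fix _ (limit_Fix g)).
move=> x Fx; have [->|xn0] := eqVneq x 0; first by rewrite normr0 scale0r.
have nx : 0 < `|x| by rewrite normr_gt0.
rewrite -{1}(limit_id Fx) -{1}(scalerKV (lt0r_neq0 nx) x) limitZ.
by rewrite bl_lescale// Ph// normrZ ger0_norm ?invr_ge0// mulVf// gt_eqF.
Qed.

Lemma finite_dim_Fix : KB_space E -> finite_dim (Fix T).
Proof.
move=> hE; have [h Fh hh] := limit_bound.
exact: finite_dim_lattice_subspace hE lattice_subspace_Fix Fh hh.
Qed.

End attracted.

(** The limit [P x] of a point of the unit ball is fixed with norm at most [M], so it and its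
    opposite lie below [M G]. With [eta = 0] the distance is then at most the norm of
    [T n x - P x]. *)
Lemma finite_dim_attraction : finite_dim (Fix T) ->
  exists (g : E) (eta : R), [/\ 0 <= g, 0 <= eta, eta < 1 &
     forall x : E, unit_ball x ->
       (fun n => dist (T n x)
          [set a + b | a in order_ball g & b in [set eta *: z | z in unit_ball]])
         @ \oo --> (0 : R)].
Proof.
move=> /finite_dim_order_bound[G G0 hG]; exists (M *: G), 0; split => //.
  exact: bl_scale_ge0.
move=> x x1.
set C : set E := [set a + b | a in order_ball _ & b in [set 0 *: z | z in unit_ball]].
have PG y : `|y| <= 1 -> P y <= M *: G.
  move=> y1; apply: le_trans (hG _ (limit_Fix y)) _.
  by rewrite bl_lescaler// (le_trans (limit_norm y))// -[leRHS]mulr1 ler_wpM2l.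
have CP : C (P x).
  exists (P x); last first.
    by exists 0; [exists 0; rewrite /unit_ball/= ?normr0 ?scaler0|rewrite addr0].
  apply: modulus_le; first exact: PG.
  by rewrite -scaleN1r -limitZ scaleN1r PG// normrN.
have lb n : lbound [set `|T n x - c| | c in C] 0 by move=> _ [c _ <-].
apply: (squeeze_cvgr (f := fun=> 0) (h := fun n => `|T n x - P x|)).
- near=> n; rewrite /dist lb_le_inf//=.
    by apply: ge_inf; [exists 0|exists (P x)].
  by exists `|T n x - P x|, (P x).
- exact: cvg_cst.
- by apply/norm_cvg0P/subr_cvg0; exact: limit_cvg.
Unshelve. all: by end_near. Qed.

End Limit.

Theorem theorem4p3 (R : realType) (E : banachLatticeType R)
    (hE : KB_space E) (e : E) (he : quasi_interior e)
    (T : nat -> {linear E -> E})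
    (hT : LR_sequence T) (hTpos : positive_sequence T) :
  (exists (g : E) (eta : R), [/\ 0 <= g, 0 <= eta, eta < 1 &
     forall x : E, unit_ball x ->
       (fun n => dist (T n x)
          [set a + b | a in order_ball g & b in [set eta *: z | z in unit_ball]])
         @ \oo --> (0 : R)])
  <->
  (strongly_convergent T /\ finite_dim (Fix T)).
Proof.
have [M M0 TM] := LR_bound hT; have [_ _ T_left T_right] := hT.
split=> [[g [eta [g0 eta0 eta1 attr]]]|[cT fT]].
  have cT : strongly_convergent T.
    by move=> x; exact: (orbit_cvg hE he M0 TM hTpos T_left T_right g0 eta0 eta1 attr).
  by split => //; exact: (finite_dim_Fix M0 TM hTpos T_right cT g0 eta0 eta1 attr hE).
exact: (finite_dim_attraction M0 TM T_right cT fT).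
Qed.
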